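(* Let $T\subset\mathbb R^2$ be a nondegenerate triangle with vertices $\mathtt v_0,\mathtt v_1,\mathtt v_2$ and barycenter $\mathtt v_c$, with barycentric refinement into subtriangles $T_0,T_1,T_2$, so that $T_1\cap T_2=[\mathtt v_0,\mathtt v_c]$. For an integer $k\ge1$ define $$v_0=\frac{4|T|^2}{9(k+1)}(\lambda_0^{\rm R})^{k+1}(\lambda_2-\lambda_1)=\frac{4|T|^2}{9(k+1)}(\lambda_0^{\rm R})^{k+1}\bigl(\lambda_2^{\rm R}\chi_{T_1}-\lambda_1^{\rm R}\chi_{T_2}\bigr).$$ Then $v_0\in C^1(T)$. Moreover, $J(v_0)=\boldsymbol\psi_0^k$, where $$\boldsymbol\psi_0^k=\bigl[2(\lambda_0^{\rm R})^k\operatorname{sym}(\boldsymbol t_{c,0}\otimes\boldsymbol t_{c,1})-k(\lambda_0^{\rm R})^{k-1}\lambda_1^{\rm R}\,\boldsymbol t_{c,1}\otimes\boldsymbol t_{c,1}\bigr]\chi_{T_2}+\bigl[-2(\lambda_0^{\rm R})^k\operatorname{sym}(\boldsymbol t_{c,0}\otimes\boldsymbol t_{c,2})+k(\lambda_0^{\rm R})^{k-1}\lambda_2^{\rm R}\,\boldsymbol t_{c,2}\otimes\boldsymbol t_{c,2}\bigr]\chi_{T_1}.$$ Consequently, $\boldsymbol\psi_0^k\in H(\operatorname{div},T;\mathbb S)$ and $\operatorname{div}\boldsymbol\psi_0^k=0$ on $T$.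
   Context: $\mathtt v_c=(\mathtt v_0+\mathtt v_1+\mathtt v_2)/3$, and $T_i$ is the convex hull of $\mathtt v_c$ and the two vertices $\mathtt v_j$, $j\neq i$; $\chi_{T_i}$ is its characteristic function. $|T|$ is the area of $T$. $\lambda_i$ is the barycentric coordinate of $T$ associated with $\mathtt v_i$; $\lambda_i^{\rm R}$ is the continuous function on $T$, affine on each $T_j$, with $\lambda_i^{\rm R}(\mathtt v_i)=1$ and value $0$ at $\mathtt v_c$ and at the other two vertices. $\boldsymbol t_{i,j}=\mathtt v_j-\mathtt v_i$ for $i,j\in\{0,1,2,c\}$. $a\otimes b=ab^{\intercal}$, $\operatorname{sym}(A)=(A+A^{\intercal})/2$, and $\mathbb S$ is the space of symmetric $2\times2$ real matrices. The Airy operator is $$J(v)=\begin{pmatrix}\partial_{yy}v&-\partial_{yx}v\\-\partial_{xy}v&\partial_{xx}v\end{pmatrix},$$ with derivatives of $C^1$ piecewise polynomial functions understood weakly (equivalently, piecewise on each $T_i$, almost everywhere). $\operatorname{div}$ acts row-wise, and $H(\operatorname{div},T;\mathbb S)$ is the space of $\mathbb S$-valued $L^2$ fields on $T$ whose distributional divergence is in $L^2(T;\mathbb R^2)$. *)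

(* Defs.v *)
From HB Require Import structures.
From mathcomp Require Import all_boot all_order all_algebra.
From mathcomp Require Import all_classical all_reals all_analysis.

Set Implicit Arguments.
Unset Strict Implicit.
Unset Printing Implicit Defensive.

Import Order.TTheory GRing.Theory Num.Theory.
Import numFieldNormedType.Exports.

Local Open Scope classical_set_scope.
Local Open Scope ring_scope.

(* Points of the plane are pairs, so that both the product topology and the
   product measure are available. *)
Notation mu2 R := (@lebesgue_measure R \x @lebesgue_measure R)%E.

Definition area (R : realType) (A : set (R * R)) : R := fine (mu2 R A).

Definition hull (R : realType) (w : 'I_3 -> R * R) : set (R * R) :=
  [set p | exists c : 'I_3 -> R,
     [/\ forall i, 0 <= c i, \sum_i c i = 1 & p = \sum_i c i *: w i]].

Definition affinely_independent (R : realType) (w : 'I_3 -> R * R) : Prop :=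
  forall c : 'I_3 -> R, \sum_i c i = 0 -> \sum_i c i *: w i = 0 ->
    forall i, c i = 0.

Definition barycenter (R : realType) (v : 'I_3 -> R * R) : R * R :=
  3^-1 *: (v 0 + v 1 + v 2).

Definition subtri (R : realType) (v : 'I_3 -> R * R) (i : 'I_3) :
    set (R * R) :=
  hull (fun j => if j == i then barycenter v else v j).

Definition affine_on (R : realType) (A : set (R * R)) (f : R * R -> R) : Prop :=
  exists a b c : R, forall p, A p -> f p = a * p.1 + b * p.2 + c.

Definition barycentric_coords (R : realType) (v : 'I_3 -> R * R)
    (lam : 'I_3 -> R * R -> R) : Prop :=
  forall p, \sum_i lam i p = 1 /\ p = \sum_i lam i p *: v i.

(* These conditions determine [lamR i] on the triangle only; nothing below
   depends on its values elsewhere. *)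
Definition refined_hats (R : realType) (v : 'I_3 -> R * R)
    (lamR : 'I_3 -> R * R -> R) : Prop :=
  forall i, [/\ {within hull v, continuous (lamR i)},
    forall j, affine_on (subtri v j) (lamR i),
    forall j, lamR i (v j) = (j == i)%:R &
    lamR i (barycenter v) = 0].

Definition edge (R : realType) (a b : R * R) : 'cV[R]_2 :=
  \col_(i < 2) (if i == 0 then (b - a).1 else (b - a).2).

Definition outer (R : realType) (a b : 'cV[R]_2) : 'M[R]_2 := a *m b^T.

Definition symp (R : realType) (A : 'M[R]_2) : 'M[R]_2 := 2^-1 *: (A + A^T).

Definition axis (R : realType) (i : 'I_2) : R * R :=
  ((i == 0)%:R, (i == 1)%:R).

Definition partial (R : realType) (i : 'I_2) (f : R * R -> R) : R * R -> R :=
  fun p => 'D_(axis R i) f p.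

(* [A] is thought of as the closure of its interior. *)
Definition C1_on (R : realType) (A : set (R * R)) (f : R * R -> R) : Prop :=
  {within A, continuous f} /\
  forall i : 'I_2, exists2 g : R * R -> R, {within A, continuous g} &
    forall p, A° p -> is_derive p (axis R i) f (g p).

Fixpoint class_C (R : realType) (n : nat) (f : R * R -> R) : Prop :=
  continuous f /\
  if n is m.+1 then
    forall i : 'I_2, (forall p, derivable f p (axis R i)) /\
                     class_C m (partial i f)
  else True.

Definition test_function (R : realType) (U : set (R * R)) (phi : R * R -> R) :
    Prop :=
  let supp := closure [set p | phi p != 0] in
  [/\ forall n, class_C n phi, compact supp & supp `<=` U].

Definition L1loc (R : realType) (U : set (R * R)) (f : R * R -> R) : Prop :=
  forall K : set (R * R), compact K -> K `<=` U ->
    (mu2 R).-integrable K (EFin \o f).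

Definition L2 (R : realType) (A : set (R * R)) (f : R * R -> R) : Prop :=
  measurable_fun (A : set (measurableTypeR R * measurableTypeR R))
    (f : measurableTypeR R * measurableTypeR R -> measurableTypeR R) /\
  (mu2 R).-integrable A (EFin \o (fun p => f p ^+ 2)).

(* [g] is the weak derivative d_i d_j [f] in the interior of [A].  The boundary
   of [A] plays no role, as the test functions vanish near it. *)
Definition weak_partial2 (R : realType) (A : set (R * R)) (i j : 'I_2)
    (f g : R * R -> R) : Prop :=
  [/\ L1loc A° f, L1loc A° g &
    forall phi, test_function A° phi ->
      \int[mu2 R]_(p in A) (f p * partial j (partial i phi) p) =
      \int[mu2 R]_(p in A) (g p * phi p)].

(* J(f) = psi; index 0 of 'I_2 is x and index 1 is y. *)
Definition weak_Airy (R : realType) (A : set (R * R)) (f : R * R -> R)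
    (psi : R * R -> 'M[R]_2) : Prop :=
  [/\ weak_partial2 A 1 1 f (fun p => psi p 0 0),
      weak_partial2 A 1 0 f (fun p => - psi p 0 1),
      weak_partial2 A 0 1 f (fun p => - psi p 1 0) &
      weak_partial2 A 0 0 f (fun p => psi p 1 1)].

Definition weak_div (R : realType) (A : set (R * R)) (psi : R * R -> 'M[R]_2)
    (d : R * R -> 'cV[R]_2) : Prop :=
  forall (i : 'I_2) phi, test_function A° phi ->
    \int[mu2 R]_(p in A) (\sum_j psi p i j * partial j phi p) =
    - \int[mu2 R]_(p in A) (d p i 0 * phi p).

Definition HdivS (R : realType) (A : set (R * R)) (psi : R * R -> 'M[R]_2) :
    Prop :=
  [/\ forall p, A p -> (psi p)^T = psi p,
      forall i j, L2 A (fun p => psi p i j) &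
      exists2 d : R * R -> 'cV[R]_2,
        forall i, L2 A (fun p => d p i 0) & weak_div A psi d].

Definition v0_fun (R : realType) (v : 'I_3 -> R * R) (k : nat)
    (lam lamR : 'I_3 -> R * R -> R) : R * R -> R :=
  fun p => 4 * area (hull v) ^+ 2 / (9 * k.+1%:R) *
    lamR 0 p ^+ k.+1 * (lam 2 p - lam 1 p).

Definition v0_piecewise (R : realType) (v : 'I_3 -> R * R) (k : nat)
    (lamR : 'I_3 -> R * R -> R) : R * R -> R :=
  fun p => 4 * area (hull v) ^+ 2 / (9 * k.+1%:R) * lamR 0 p ^+ k.+1 *
    (lamR 2 p * \1_(subtri v 1) p - lamR 1 p * \1_(subtri v 2) p).

Definition psi0 (R : realType) (v : 'I_3 -> R * R) (k : nat)
    (lamR : 'I_3 -> R * R -> R) : R * R -> 'M[R]_2 :=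
  let t i := edge (barycenter v) (v i) in
  fun p =>
    \1_(subtri v 2) p *:
      ((2 * lamR 0 p ^+ k) *: symp (outer (t 0) (t 1))
       - (k%:R * lamR 0 p ^+ k.-1 * lamR 1 p) *: outer (t 1) (t 1)) +
    \1_(subtri v 1) p *:
      (- ((2 * lamR 0 p ^+ k) *: symp (outer (t 0) (t 2)))
       + (k%:R * lamR 0 p ^+ k.-1 * lamR 2 p) *: outer (t 2) (t 2)).

(* Main.v *)
From HB Require Import structures.
Require Import Defs.
From mathcomp Require Import all_boot all_order all_algebra.
From mathcomp Require Import all_classical all_reals all_analysis.
From mathcomp Require Import measurable_realfun ring lra.

(** On the triangle the refined hat function at v_0 is max(0, x, y), where
x = lambda_0 - lambda_1 and y = lambda_0 - lambda_2 are affine, and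
lambda_2 - lambda_1 = x - y.  Hence v_0 = c ramp_{k+1}(max(x, y)) (x - y) with
ramp_n(u) = u^n for u > 0 and 0 otherwise: a formula that makes sense on the
whole plane (lemma [v0_funE]).

The function so extended is C^1.  Where x <> y it is locally ramp_{k+1} of an
affine function times an affine function, and k + 1 >= 2; on the line x = y
the two formulas have the same value and the same gradient, because x - y
vanishes there ([potential_is_derive]).  Its gradient is locally Lipschitz and
is differentiable off the three lines x = 0, y = 0, x = y
([potential_deriv_is_derive]).  The Airy matrix is the Hessian conjugated by a
quarter turn, and turning the gradients of x and y gives multiples of t_{c,2}
and t_{c,1}; since t_{c,0} = - t_{c,1} - t_{c,2}, the second derivatives then
become psi_0^k, the factor 4|T|^2 being the squared determinant of the
triangle ([psi0_potential], [areaE]).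

Pointwise derivatives are also weak ones.  A Lipschitz function H with compact
support satisfies int d_w H = 0: its difference quotients have integral zero,
as the measure is invariant under translations, and dominated convergence
applies ([integral_derive_eq0]).  With H = F phi this is integration by parts
([weak_derivative_plane]); applied to v_0 and to its gradient, it gives
J(v_0) = psi_0^k, since test functions vanish outside T and integrals over T
may be taken over the plane.

Finally each row of psi_0^k is the rotated gradient of a first derivative g of
v_0, so that int psi_i . grad phi = +- int g (d_x d_y phi - d_y d_x phi) = 0 by
the symmetry of second derivatives ([mixed_derivatives], [psi0_weak_div]). *)

Import Order.TTheory GRing.Theory Num.Theory.
Import numFieldNormedType.Exports.
Local Open Scope classical_set_scope.
Local Open Scope ring_scope.

Set Implicit Arguments.
Unset Strict Implicit.
Unset Printing Implicit Defensive.

(** * Lebesgue measure of the plane under affine maps *)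

(** Same carrier as [R * R], but carrying the product sigma-algebra, on which
[mu2] lives. *)
Notation plane R := (measurableTypeR R * measurableTypeR R)%type.

(** The pushforward as a bundled measure, with its measurability proof explicit. *)
Notation pushforward_measure m mf :=
  (measure_function_pushforward__canonical__measure_function_Measure m mf).

Lemma lebesgue_measure_affine (R : realType) (a c : R) (B : set R) : a != 0 ->
  measurable B ->
  lebesgue_measure [set x | B (a * x + c)] = (`|a|^-1%:E * lebesgue_measure B)%E.
Proof.
move=> a0 mB.
pose f0 (x : measurableTypeR R) : measurableTypeR R := a * x + c.
have mf : measurable_fun setT f0.
  by apply: measurable_funD => //; apply: measurable_funM.
have na : 0 <= `|a| by [].
pose m := mscale (NngNum na) (pushforward_measure (@lebesgue_measure R) mf).
have mE X : ocitv X -> lebesgue_measure X = m X.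
  move=> [[u w] _ <-]; rewrite /m /mscale /= /pushforward.
  have [a_lt0|a_gt0|] := ltgtP a 0; last by move/eqP; rewrite (negbTE a0).
  - rewrite [X in (_ * lebesgue_measure X)%E](_ :
        _ = `[(w - c) / a, (u - c) / a[%classic); last first.
      apply/seteqP; split=> x; rewrite /f0 /= !in_itv/= => /andP[h1 h2]; apply/andP.
        by rewrite ler_ndivrMr // ltr_ndivlMr // (mulrC x); split; lra.
      by move: h1 h2; rewrite ler_ndivrMr // ltr_ndivlMr // (mulrC x); split; lra.
    rewrite !lebesgue_measure_itv /= !lte_fin ltr_nM2r ?invr_lt0 //.
    rewrite ltrD2r; case: ifP => _; last by rewrite mule0.
    rewrite -!EFinB -EFinM ltr0_norm //; congr EFin; by field.
  - rewrite [X in (_ * lebesgue_measure X)%E](_ :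
        _ = `](u - c) / a, (w - c) / a]%classic); last first.
      apply/seteqP; split=> x; rewrite /f0 /= !in_itv/= => /andP[h1 h2]; apply/andP.
        by rewrite ler_pdivlMr // ltr_pdivrMr // (mulrC x); split; lra.
      by move: h1 h2; rewrite ler_pdivlMr // ltr_pdivrMr // (mulrC x); split; lra.
    rewrite !lebesgue_measure_itv /= !lte_fin ltr_pM2r ?invr_gt0 //.
    rewrite ltrD2r; case: ifP => _; last by rewrite mule0.
    rewrite -!EFinB -EFinM gtr0_norm //; congr EFin; by field.
rewrite (lebesgue_measure_unique mE mB) /m /mscale /= /pushforward.
by rewrite muleA -EFinM mulVf ?mul1e // normr_eq0.
Qed.

Lemma measurable_affine (R : realType) (a b c : R) :
  measurable_fun [set: plane R] (fun p => a * p.1 + b * p.2 + c : measurableTypeR R).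
Proof.
by apply: measurable_funD => //; apply: measurable_funD; apply: measurable_funM.
Qed.

(** Every vertical section undergoes a one-dimensional affine map; the
translation part may vary with the section, so that [g] is arbitrary. *)
Lemma mu2_affine_snd (R : realType) (a : R) (g : R -> R)
    (B : set (plane R)) : a != 0 -> measurable B ->
  mu2 R [set p | B (p.1, a * p.2 + g p.1)] = (`|a|^-1%:E * mu2 R B)%E.
Proof.
move=> a0 mB; rewrite /product_measure1 /=.
rewrite -ge0_integralZl //; last first.
  by apply: measurable_fun_xsection => //; rewrite inE.
apply: eq_integral => x _.
by rewrite -(@lebesgue_measure_affine R a (g x)) //; last exact: measurable_xsection.
Qed.

Lemma mu2_swap (R : realType) (B : set (plane R)) : measurable B ->
  mu2 R [set p | B (p.2, p.1)] = mu2 R B.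
Proof.
move=> mB.
pose f (p : plane R) : plane R := (p.2, p.1).
have mf : measurable_fun setT f by exact: measurable_swap.
rewrite (@product_measure_unique _ _ _ _ R (@lebesgue_measure R)
  (@lebesgue_measure R) (pushforward_measure (mu2 R) mf) _ B) //.
move=> X Y mX mY; rewrite /= .
rewrite /pushforward (_ : f @^-1` _ = Y `*` X).
  by rewrite [LHS]product_measure1E // muleC.
by apply/seteqP; split => -[x y] /= [].
Qed.

(** The map is a composite of two maps that are affine in one variable, with
coefficients [b2] and [(a1 * b2 - a2 * b1) / b2]; exchanging the coordinates of
[B] gives [b2 != 0]. *)
Lemma mu2_affine (R : realType) (a1 b1 c1 a2 b2 c2 : R) (B : set (plane R)) :
  a1 * b2 - a2 * b1 != 0 -> measurable B ->
  mu2 R [set p | B (a1 * p.1 + b1 * p.2 + c1, a2 * p.1 + b2 * p.2 + c2)] =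
    (`|a1 * b2 - a2 * b1|^-1%:E * mu2 R B)%E.
Proof.
wlog b20 : a1 b1 c1 a2 b2 c2 B / b2 != 0.
  move=> H D0 mB; have [b20|/H] := eqVneq b2 0; last exact.
  have b10 : b1 != 0.
    by apply: contra_neq D0 => ->; rewrite b20 !mulr0 subrr.
  have mB' : measurable [set p : plane R | B (p.2, p.1)].
    by rewrite -[X in measurable X]setTI; exact: measurable_swap.
  have := H a2 b2 c2 a1 b1 c1 [set p | B (p.2, p.1)] b10.
  by rewrite -opprB oppr_eq0 normrN mu2_swap //; exact.
move=> D0 mB.
(* Solving the second coordinate for [p.2] expresses the first one through
   [p.1] and the second. *)
set D := a1 * b2 - a2 * b1 in D0 *.
pose h t := b1 * (t - c2) / b2 + c1.
pose B2 : set (plane R) := [set q | B (D / b2 * q.1 + h q.2, q.2)].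
have mB2 : measurable B2.
  rewrite /B2 -[X in measurable X]setTI.
  apply: (@measurable_fun_pair _ _ _ _ _ _
    (fun q : plane R => D / b2 * q.1 + h q.2 : measurableTypeR R) snd) => //.
  have := @measurable_affine R (D / b2) (b1 / b2) (c1 - b1 * c2 / b2).
  by apply: eq_measurable_fun => p _; by rewrite /h; field.
have -> : [set p : R * R | B (a1 * p.1 + b1 * p.2 + c1, a2 * p.1 + b2 * p.2 + c2)]
   = [set p | B2 (p.1, b2 * p.2 + (a2 * p.1 + c2))].
  have E x y : D / b2 * x + h (b2 * y + (a2 * x + c2)) = a1 * x + b1 * y + c1.
    by rewrite /D /h; field.
  by apply/seteqP; split => -[x y]; rewrite /B2 /= E (addrA (b2 * y)) (addrC (b2 * y)).
rewrite (@mu2_affine_snd R b2 (fun x => a2 * x + c2)) //.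
have -> : mu2 R B2 = (`|D / b2|^-1%:E * mu2 R B)%E.
  have mB' : measurable [set p : plane R | B (p.2, p.1)].
    by rewrite -[X in measurable X]setTI; exact: measurable_swap.
  rewrite -(mu2_swap mB) -(@mu2_affine_snd R (D / b2) h) //; last first.
    by rewrite mulf_neq0 // invr_eq0.
  rewrite -mu2_swap //.
rewrite muleA -EFinM; congr ((_%:E) * _)%E.
rewrite normrM normfV invfM invrK mulrCA mulVf ?mulr1 // normr_eq0 //.
Qed.

Lemma mu2_line (R : realType) (a b c : R) : (a != 0) || (b != 0) ->
  mu2 R [set p | a * p.1 + b * p.2 + c = 0] = 0%E.
Proof.
wlog b0 : a b / b != 0.
  move=> H; have [b0|b0] := eqVneq b 0; last by move=> _; apply: H => //; rewrite b0 orbT.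
  rewrite orbF => a0; rewrite -(H b a) ?a0 ?orbT //.
  have mL : measurable [set p : plane R | a * p.1 + b * p.2 + c = 0].
    rewrite -[X in measurable X]setTI.
    by apply: (@measurable_affine R a b c measurableT [set 0]).
  rewrite -mu2_swap //; congr (mu2 R _); apply/seteqP; split => p /= Hp; lra.
move=> _; rewrite /product_measure1 /=; apply: integral0_eq => x _.
rewrite (_ : xsection _ _ = [set (- c - a * x) / b]) ?lebesgue_measure_set1 //.
apply/seteqP; split => y; rewrite /xsection /= inE /=.
  by move=> H; apply: (mulIf b0); rewrite mulfVK //; lra.
by move=> ->; field.
Qed.

Lemma measurable_half_plane (R : realType) (a b c : R) :
  measurable [set p : plane R | 0 <= a * p.1 + b * p.2 + c].
Proof.
rewrite (_ : [set _ | _] = setT `&`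
  (fun p : plane R => a * p.1 + b * p.2 + c : measurableTypeR R)
    @^-1` `[0, +oo[%classic).
  by apply: (@measurable_affine R a b c) => //; exact: measurable_itv.
by apply/seteqP; split => p; rewrite /= in_itv /= andbT // => -[].
Qed.

Lemma measurable_line (R : realType) (a b c : R) :
  measurable [set p : plane R | a * p.1 + b * p.2 + c = 0].
Proof.
rewrite -[X in measurable X]setTI.
by apply: (@measurable_affine R a b c measurableT [set 0]).
Qed.

Definition unit_triangle (R : realType) : set (plane R) :=
  [set p | [/\ 0 <= p.1, 0 <= p.2 & p.1 + p.2 <= 1]].

Lemma measurable_unit_triangle (R : realType) : measurable (@unit_triangle R).
Proof.
rewrite (_ : @unit_triangle R = [set p : plane R | 0 <= 1 * p.1 + 0 * p.2 + 0] `&`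
  [set p : plane R | 0 <= 0 * p.1 + 1 * p.2 + 0] `&`
  [set p : plane R | 0 <= (-1) * p.1 + (-1) * p.2 + 1]).
  by apply: measurableI; [apply: measurableI|]; exact: measurable_half_plane.
apply/seteqP; split => p; rewrite /unit_triangle /=.
  by move=> [h1 h2 h3]; split; [split|]; lra.
by move=> [[h1 h2] h3]; split; lra.
Qed.

(** The half-turn around (1/2, 1/2) preserves the measure and maps the triangle
to the other half of the unit square; the two halves share only a diagonal. *)
Lemma mu2_unit_triangle (R : realType) : mu2 R (@unit_triangle R) = 2^-1%:E.
Proof.
pose U := @unit_triangle R.
pose L := [set p : plane R | 1 * p.1 + 1 * p.2 + (-1) = 0].
pose U' := [set p : plane R | U (-1 * p.1 + 0 * p.2 + 1, 0 * p.1 + -1 * p.2 + 1)].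
pose I : set R := `[0, 1]%classic.
have US : I `*` I = U `|` (U' `\` L).
  have IE (x : R) : I x = (0 <= x <= 1) :> Prop by rewrite /I /= in_itv.
  apply/seteqP; split => -[x y]; rewrite /U /U' /L /unit_triangle /= !IE.
    move=> [/andP[h1 h2] /andP[h3 h4]].
    have [h5|h5] := lerP (x + y) 1; [left|right]; first by split.
    by split; [split => /=; lra|move=> /= h6; lra].
  by move=> [[h1 h2 h3]|[[/= h1 h2 h3] /= h4]]; split; apply/andP; split; lra.
have dU : U `&` (U' `\` L) = set0.
  apply/seteqP; split => -[x y] //; rewrite /U /U' /L /unit_triangle /=.
  by move=> [[h1 h2 h3] [[/= h4 h5 h6] /= h7]]; apply: h7; lra.
have mU : measurable U by exact: measurable_unit_triangle.
have mL : measurable L by exact: measurable_line.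
have L0 : mu2 R L = 0%E by apply: mu2_line; rewrite oner_neq0.
have mU' : measurable U'.
  rewrite /U' -[X in measurable X]setTI.
  apply: (@measurable_fun_pair _ _ _ _ _ _
    (fun p : plane R => -1 * p.1 + 0 * p.2 + 1 : measurableTypeR R)
    (fun p : plane R => 0 * p.1 + -1 * p.2 + 1 : measurableTypeR R)) => //;
    exact: measurable_affine.
have U'E : mu2 R U' = mu2 R U.
  rewrite mu2_affine // ?mulr0 ?mul0r ?subr0 ?mulrNN ?mulr1 ?oner_neq0 //.
  by rewrite normr1 invr1 mul1e.
have mI : measurable (I : set (measurableTypeR R)) by exact: measurable_itv.
have I1 : lebesgue_measure I = 1%E.
  by rewrite /I lebesgue_measure_itv /= lte_fin ltr01 sube0.
have SE : mu2 R (I `*` I) = 1%E.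
  by rewrite [LHS]product_measure1E //= I1 mule1.
have mD : measurable (U' `\` L) by exact: measurableD.
have U'D : mu2 R (U' `\` L) = mu2 R U'.
  rewrite [RHS](measureDI (mu2 R) mU' mL).
  rewrite [X in (_ + X)%E](_ : _ = 0%E) ?adde0 //.
  by apply: (subset_measure0 _ _ _ L0) => //; exact: measurableI.
move: SE; rewrite US measureU //= U'D U'E -/U.
have : (0 <= mu2 R U)%E by [].
case: (mu2 R U) => [r| |] //= _; rewrite -EFinD => -[] h.
by congr EFin; lra.
Qed.

Lemma mu2_triangle (R : realType) (a1 b1 c1 a2 b2 c2 : R) :
  a1 * b2 - a2 * b1 != 0 ->
  mu2 R [set p | unit_triangle (a1 * p.1 + b1 * p.2 + c1, a2 * p.1 + b2 * p.2 + c2)]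
  = ((2 * `|a1 * b2 - a2 * b1|)^-1)%:E.
Proof.
move=> D0; rewrite mu2_affine //; last exact: measurable_unit_triangle.
by rewrite mu2_unit_triangle -EFinM -invfM mulrC.
Qed.

(** * Measurability and integrability in the plane *)

(** An open set is the union of the boxes with rational corners that it contains,
here enumerated through [unpickle]. *)
Lemma open_measurable_plane (R : realType) (U : set (R * R)) :
  open U -> measurable (U : set (plane R)).
Proof.
move=> oU.
pose box (q : (rat * rat) * (rat * rat)) : set (plane R) :=
  `]ratr q.1.1, ratr q.1.2[%classic `*` `]ratr q.2.1, ratr q.2.2[%classic.
pose F (n : nat) : set (plane R) :=
  if @unpickle ((rat * rat) * (rat * rat))%type n is Some q then
    if `[< box q `<=` U >] then box q else set0 else set0.
rewrite (_ : U = \bigcup_n F n).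
  apply: bigcupT_measurable => n; rewrite /F; case: unpickle => // q.
  case: asboolP => // _; apply: measurableX; exact: measurable_itv.
apply/seteqP; split => [p Up|p [n _]]; last first.
  by rewrite /F; case: unpickle => // q; case: asboolP => // qU; exact: qU.
have /nbhs_ballP[e /= e0 pe] : nbhs p U by move: oU; rewrite openE; apply.
have rat_near (x : R) : exists a b : rat,
    [/\ ratr a < x, x < ratr b, x - e < ratr a & ratr b < x + e].
  have /rat_in_itvoo[a] : x - e < x by rewrite ltrBlDr ltrDl.
  have /rat_in_itvoo[b] : x < x + e by rewrite ltrDl.
  by rewrite !in_itv /= => /andP[? ?] /andP[? ?]; exists a, b.
have [a [b [pa pb ae be]]] := rat_near p.1.
have [c [d [pc pd ce de]]] := rat_near p.2.
exists (pickle ((a, b), (c, d))); first exact: I.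
rewrite /F pickleK.
case: asboolP => [_|[]].
  by split; rewrite /= in_itv /=; apply/andP; split.
move=> q [] /=; rewrite !in_itv /= => /andP[h1 h2] /andP[h3 h4].
apply: pe; split; rewrite -ball_normE /=; rewrite ltr_norml; apply/andP; split; lra.
Qed.

Lemma closed_measurable_plane (R : realType) (U : set (R * R)) :
  closed U -> measurable (U : set (plane R)).
Proof.
move=> /closed_openC /open_measurable_plane.
by move=> /measurableC; rewrite setCK.
Qed.

Lemma measurable_norm_le (R : realType) (r : R) :
  measurable ([set p : R * R | `|p| <= r] : set (plane R)).
Proof.
apply: closed_measurable_plane.
apply: (@closed_comp _ _ (fun p : R * R => `|p|) [set x | x <= r]).
  by move=> p _; exact: norm_continuous.
exact: closed_le.
Qed.

Lemma compact_measurable_plane (R : realType) (K : set (R * R)) :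
  compact K -> measurable (K : set (plane R)).
Proof.
by move=> cK; apply: closed_measurable_plane; apply: compact_closed.
Qed.

Lemma continuous_measurable_plane (R : realType) (f : R * R -> R) :
  continuous f ->
  measurable_fun [set: plane R] (f : plane R -> measurableTypeR R).
Proof.
move=> /continuousP cf; apply: (measurability _ (RGenOpens.measurableE R)).
move=> _ [_ [a [b ->] <-]]; rewrite setTI.
by apply: open_measurable_plane; apply: cf; exact: interval_open.
Qed.

Lemma mu2_bounded_fin (R : realType) (A : set (plane R)) (r : R) :
  measurable A -> (forall p : R * R, A p -> `|p| <= r) -> (mu2 R A < +oo)%E.
Proof.
move=> mA Ar.
pose I : set R := `[- r, r]%classic.
have mI : measurable (I : set (measurableTypeR R)) by exact: measurable_itv.
have mII : measurable (I `*` I : set (plane R)) by exact: measurableX.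
apply: (@le_lt_trans _ _ (mu2 R (I `*` I))).
  apply: le_measure; rewrite ?inE // => p /Ar.
  rewrite /Num.norm /= ge_max => /andP[].
  by rewrite !ler_norml /I /= !in_itv /=; split.
have I1 : (lebesgue_measure I < +oo)%E.
  rewrite /I lebesgue_measure_itv /= lte_fin; case: ifP => // _.
  by rewrite -EFinB ltry.
rewrite [X in (X < _)%E]product_measure1E //=.
by apply: lte_mul_pinfty => //; rewrite ge0_fin_numE.
Qed.

Lemma bounded_integrable_plane (R : realType) (A : set (plane R))
    (f : plane R -> R) (M r : R) :
  measurable A -> measurable_fun A f ->
  (forall p : R * R, A p -> `|f p| <= M /\ `|p| <= r) ->
  (mu2 R).-integrable A (EFin \o f).
Proof.
move=> mA mf fM; apply: measurable_bounded_integrable => //.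
  by apply: (@mu2_bounded_fin R A r) => // p /fM[].
exists M; split; first exact: num_real.
by move=> x Mx p /fM[h _]; exact: le_trans h (ltW Mx).
Qed.

Lemma compact_support_integrable (R : realType) (f : plane R -> R) (M r : R) :
  measurable_fun setT f -> (forall p : R * R, `|f p| <= M) ->
  (forall p : R * R, r < `|p| -> f p = 0) ->
  (mu2 R).-integrable setT (EFin \o f).
Proof.
move=> mf fM fr.
pose A : set (plane R) := [set p : R * R | `|p| <= r].
have mA : measurable A by exact: measurable_norm_le.
have iA : (mu2 R).-integrable A (EFin \o f).
  apply: (@bounded_integrable_plane R A f M r) => //.
  exact: measurable_funS mf.
have := (integrable_mkcond (mu := mu2 R) (EFin \o f) mA).1 iA.
rewrite (_ : _ \_ A = EFin \o f) //; apply/funext => p; rewrite /patch.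
case: ifPn => // /negP pA; rewrite /= fr // ltNge; apply/negP => h.
by apply: pA; rewrite inE.
Qed.

(** * Integration by parts for Lipschitz functions *)

Lemma measurable_shift_plane (R : realType) (w : R * R) :
  measurable_fun setT (fun p : plane R => (p.1 + w.1, p.2 + w.2) : plane R).
Proof.
apply: measurable_fun_pair; apply: measurable_funD.
- exact: measurable_fst.
- exact: measurable_cst.
- exact: measurable_snd.
- exact: measurable_cst.
Qed.

Lemma mu2_shift (R : realType) (w : R * R) (B : set (plane R)) :
  measurable B -> mu2 R [set p | B (p.1 + w.1, p.2 + w.2)] = mu2 R B.
Proof.
move=> mB; have := @mu2_affine R 1 0 w.1 0 1 w.2 B.
rewrite mulr1 mul0r subr0 normr1 invr1 mul1e => <- //.
congr (mu2 R _); apply/seteqP; split => p /=; rewrite !mul1r !mul0r addr0 add0r //.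
Qed.

Lemma Rintegral_shift_plane (R : realType) (w : R * R) (f : plane R -> R) :
  measurable_fun setT f ->
  (mu2 R).-integrable setT (EFin \o (fun p => f (p.1 + w.1, p.2 + w.2))) ->
  \int[mu2 R]_p f (p.1 + w.1, p.2 + w.2) = \int[mu2 R]_p f p.
Proof.
move=> mf ifs.
pose s (p : plane R) : plane R := (p.1 + w.1, p.2 + w.2).
have ms : measurable_fun setT s by exact: measurable_shift_plane.
rewrite /Rintegral; congr fine.
rewrite [RHS](@eq_measure_integral _ _ _ setT (pushforward_measure (mu2 R) ms)).
  rewrite [RHS]integral_pushforward //.
  exact/measurable_EFinP.
by move=> A mA _; rewrite /= /pushforward [in RHS]mu2_shift.
Qed.

Lemma is_derive_cvg_harmonic (R : realType) (H : R * R -> R) (p w : R * R) (d : R) :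
  is_derive p w H d ->
  (n.+1%:R * (H (p + n.+1%:R^-1 *: w) - H p)) @[n --> \oo] --> d.
Proof.
move=> [dH <-].
have h0 : (@harmonic R) @ \oo --> (0 : R)^'.
  move=> A A0.
  have : \forall n \near \oo, @harmonic R n != 0 -> A (harmonic n).
    exact: (@cvg_harmonic R _ A0).
  by apply: filterS => n; apply; rewrite invr_eq0 pnatr_eq0.
have := cvg_comp _ _ h0 dH.
rewrite /= => Hc; apply: cvg_trans Hc.
apply: near_eq_cvg; apply: nearW => n /=.
by rewrite /harmonic /= invrK (addrC p).
Qed.

(** The difference quotients of [H] along [w] have integral zero because the
measure is translation invariant; they are dominated by [L] on a ball that
contains all the translated supports, and converge to [h]. *)
Lemma integral_derive_eq0 (R : realType) (H h : plane R -> R) (w : R * R)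
    (L M r : R) :
  `|w| <= 1 ->
  measurable_fun setT H -> measurable_fun setT h ->
  (forall p : R * R, `|H p| <= M) ->
  (forall p : R * R, r < `|p| -> H p = 0) ->
  (forall (p : R * R) (t : R), 0 < t <= 1 -> `|H (p + t *: w) - H p| <= L * t) ->
  {ae mu2 R, forall p : plane R, is_derive (p : R * R) w (H : R * R -> R) (h p)} ->
  (mu2 R).-integrable setT (EFin \o h) /\ \int[mu2 R]_p h p = 0.
Proof.
move=> w1 mH mh HM Hr HL dH.
pose e n := n.+1%:R^-1 : R.
have e01 n : 0 < e n <= 1 by rewrite invr_gt0 ltr0n invf_le1 ?ltr0n // ler1n.
pose sh n p := H (p.1 + (e n *: w).1, p.2 + (e n *: w).2).
have msh n : measurable_fun setT (sh n).
  exact: measurableT_comp (@measurable_shift_plane R (e n *: w)).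
have shr n (p : R * R) : r + 1 < `|p| -> sh n p = 0.
  move=> rp; apply: Hr; rewrite -[X in `|X|]/(p + e n *: w).
  have : `|p| <= `|p + e n *: w| + `|e n *: w|.
    by rewrite -[X in `|X| <= _](addrK (e n *: w)) ler_normB.
  have /andP[en0 en1] := e01 n.
  have : `|e n *: w| <= 1 by rewrite normrZ gtr0_norm // mulr_ile1 // ltW.
  lra.
have iH : (mu2 R).-integrable setT (EFin \o H).
  exact: compact_support_integrable HM Hr.
have ish n : (mu2 R).-integrable setT (EFin \o sh n).
  apply: (compact_support_integrable (M := M) (r := r + 1)) .
  - exact: msh.
  - by move=> p; exact: HM.
  - by move=> p; exact: shr.
pose f n p := n.+1%:R * (sh n p - H p).
have mf n : measurable_fun setT (f n).
  apply: measurable_funM => //; exact: measurable_funB.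
have iB n : (mu2 R).-integrable setT (EFin \o (fun p => sh n p - H p)).
  by have := integrableB measurableT (ish n) iH.
have ifn n : (mu2 R).-integrable setT (EFin \o f n).
  by have := integrableZl measurableT n.+1%:R (iB n).
have int0 n : \int[mu2 R]_p f n p = 0.
  rewrite RintegralZl //.
  rewrite RintegralB //.
  apply/eqP; rewrite mulf_eq0 subr_eq0; apply/orP; right; apply/eqP.
  by apply: (@Rintegral_shift_plane R (e n *: w) H) => //; exact: ish.
pose A : set (plane R) := [set p : R * R | `|p| <= r + 1].
have mA : measurable A by exact: measurable_norm_le.
pose g (p : plane R) : R := L * \1_A p.
have ig : (mu2 R).-integrable setT (EFin \o g).
  apply: (compact_support_integrable (M := `|L|) (r := r + 1)).
  - by apply: measurable_funM => //; exact: measurable_indic.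
  - move=> p; rewrite /g normrM indicE; case: (_ \in _).
      by rewrite normr1 mulr1.
    by rewrite normr0 mulr0.
  - move=> p; rewrite /g indicE ltNge => /negP rp.
    by rewrite memNset ?mulr0.
have fg (p : plane R) n : `|f n p| <= g p.
  rewrite /g indicE; have [pA|pA] := boolP (p \in A).
    rewrite mulr1 /f normrM normr_nat mulrC -ler_pdivlMr ?ltr0n //.
    exact: (HL p (e n)).
  move: pA; rewrite notin_setE /A /= => /negP; rewrite -ltNge => rp.
  rewrite mulr0 /f shr // Hr ?subrr ?mulr0 ?normr0 //.
  by apply: lt_trans rp; rewrite ltrDl.
have := @dominated_convergence _ _ _ (mu2 R) setT measurableT
  (fun n => EFin \o f n) (EFin \o h) (EFin \o g).
case.
- by move=> n /=; apply/measurable_EFinP; exact: mf.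
- exact/measurable_EFinP.
- apply: filterS dH => p dp _; apply: cvg_EFin; first exact: nearW.
  exact: is_derive_cvg_harmonic.
- exact: ig.
- by apply: aeW => p n _; rewrite /= lee_fin.
move=> ih _ fh; split => //.
have : (fun=> 0%E : \bar R) @ \oo --> (\int[mu2 R]_p (h p)%:E)%E.
  apply: cvg_trans fh; apply: near_eq_cvg; apply: nearW => n.
  rewrite -[LHS](fineK (integrable_fin_num _ (ifn n))) //.
  congr EFin; exact: int0.
move=> /cvg_unique -/(_ _ _ (cvg_cst _)); rewrite /Rintegral => -> //.
Qed.

(** Locally uniform Lipschitz continuity in the direction [w], together with local
boundedness, so that the class is stable under products. *)
Definition lipschitz_along (R : realType) (w : R * R) (f : R * R -> R) : Prop :=
  forall r, exists2 L, 0 <= L & forall (p : R * R) (t : R), `|p| <= r ->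
    0 < t <= 1 -> `|f p| <= L /\ `|f (p + t *: w) - f p| <= L * t.

Section lipschitz_along_theory.
Variables (R : realType) (w : R * R).
Implicit Types f g : R * R -> R.

Lemma lipschitz_along_le f g :
  (exists2 K, 0 <= K & forall p q, `|g p - g q| <= K * `|f p - f q|) ->
  lipschitz_along w f -> lipschitz_along w g.
Proof.
move=> [K K0 gf] lf r; have [L L0 fL] := lf r.
exists (`|g 0| + K * (L + `|f 0|)) => [|p t pr t01].
  by rewrite addr_ge0 // mulr_ge0 // addr_ge0.
have [f1 f2] := fL p t pr t01.
split.
  have -> : g p = g 0 + (g p - g 0) by rewrite addrC subrK.
  apply: le_trans (ler_normD _ _) _; rewrite lerD2l.
  apply: le_trans (gf _ _) _; apply: ler_wpM2l => //.
  by apply: le_trans (ler_normB _ _) _; rewrite lerD2r.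
apply: le_trans (gf _ _) _.
have /andP[/ltW t0 _] := t01.
apply: (@le_trans _ _ (K * (L * t))); first exact: ler_wpM2l.
rewrite mulrA; apply: ler_wpM2r => //.
have : 0 <= K * `|f 0| by apply: mulr_ge0.
have : 0 <= `|g 0| by [].
rewrite mulrDr; lra.
Qed.

Lemma lipschitz_alongD f g : lipschitz_along w f -> lipschitz_along w g ->
  lipschitz_along w (fun p => f p + g p).
Proof.
move=> lf lg r; have [L L0 fL] := lf r; have [K K0 gK] := lg r.
exists (L + K) => [|p t pr t01]; first exact: addr_ge0.
have [f1 f2] := fL p t pr t01; have [g1 g2] := gK p t pr t01.
split; first by apply: le_trans (ler_normD _ _) _; exact: lerD.
by rewrite opprD addrACA mulrDl; apply: le_trans (ler_normD _ _) _; exact: lerD.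
Qed.

Lemma lipschitz_alongM f g : lipschitz_along w f -> lipschitz_along w g ->
  lipschitz_along w (fun p => f p * g p).
Proof.
move=> lf lg r; have [L L0 fL] := lf r; have [K K0 gK] := lg r.
exists (3 * (L * K)) => [|p t pr t01]; first by rewrite !mulr_ge0.
have [f1 f2] := fL p t pr t01; have [g1 g2] := gK p t pr t01.
have LK : 0 <= L * K by exact: mulr_ge0.
have fg : `|f p| * `|g p| <= L * K by apply: ler_pM.
split; first by rewrite normrM; lra.
have /andP[t0 t1] := t01.
have -> : f (p + t *: w) * g (p + t *: w) - f p * g p =
  (f (p + t *: w) - f p) * (g (p + t *: w) - g p)
  + (f (p + t *: w) - f p) * g p + f p * (g (p + t *: w) - g p) by ring.
apply: le_trans (ler_normD _ _) _.
apply: le_trans (lerD (ler_normD _ _) (lexx _)) _.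
rewrite !normrM.
have h1 : `|f (p + t *: w) - f p| * `|g (p + t *: w) - g p| <= (L * t) * (K * t).
  exact: ler_pM.
have h2 : `|f (p + t *: w) - f p| * `|g p| <= (L * t) * K by exact: ler_pM.
have h3 : `|f p| * `|g (p + t *: w) - g p| <= L * (K * t) by exact: ler_pM.
have h4 : (L * t) * (K * t) <= L * t * K.
  by apply: ler_wpM2l; [rewrite mulr_ge0 // ltW|exact: ler_piMr].
nra.
Qed.

Lemma lipschitz_along_affine (a b c : R) :
  lipschitz_along w (fun p => a * p.1 + b * p.2 + c).
Proof.
move=> r.
exists (`|a| * `|r| + `|b| * `|r| + `|c| + `|a * w.1 + b * w.2|) => [|p t pr t01].
  by rewrite !addr_ge0 // mulr_ge0.
have pr1 : `|p.1| <= `|r|.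
  by apply: le_trans (ler_norm r); apply: le_trans pr; rewrite le_max lexx.
have pr2 : `|p.2| <= `|r|.
  by apply: le_trans (ler_norm r); apply: le_trans pr; rewrite le_max lexx orbT.
have h1 : `|a * p.1| <= `|a| * `|r| by rewrite normrM ler_wpM2l.
have h2 : `|b * p.2| <= `|b| * `|r| by rewrite normrM ler_wpM2l.
have h3 := ler_normD (a * p.1 + b * p.2) c.
have h4 := ler_normD (a * p.1) (b * p.2).
have h5 : 0 <= `|a * w.1 + b * w.2| by [].
split; first lra.
have -> : a * (p + t *: w).1 + b * (p + t *: w).2 + c - (a * p.1 + b * p.2 + c)
   = (a * w.1 + b * w.2) * t by rewrite /= /GRing.scale /=; ring.
have /andP[t0 t1] := t01.
rewrite normrM (gtr0_norm t0); apply: ler_wpM2r; first exact: ltW.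
have h6 : 0 <= `|a| * `|r| by apply: mulr_ge0.
have h7 : 0 <= `|b| * `|r| by apply: mulr_ge0.
have h8 : 0 <= `|c| by [].
lra.
Qed.

Lemma lipschitz_along_cst (c : R) : lipschitz_along w (fun=> c).
Proof.
have := lipschitz_along_affine 0 0 c.
by under eq_fun do rewrite !mul0r !add0r.
Qed.

Lemma lipschitz_alongZ (c : R) f : lipschitz_along w f ->
  lipschitz_along w (fun p => c * f p).
Proof. by move=> lf; apply: lipschitz_alongM => //; exact: lipschitz_along_cst. Qed.

Lemma lipschitz_alongN f : lipschitz_along w f ->
  lipschitz_along w (fun p => - f p).
Proof. by move=> lf; under eq_fun do rewrite -mulN1r; exact: lipschitz_alongZ. Qed.

Lemma lipschitz_alongB f g : lipschitz_along w f -> lipschitz_along w g ->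
  lipschitz_along w (fun p => f p - g p).
Proof. by move=> lf lg; apply: lipschitz_alongD => //; exact: lipschitz_alongN. Qed.

Lemma lipschitz_alongX n f : lipschitz_along w f ->
  lipschitz_along w (fun p => f p ^+ n).
Proof.
move=> lf; elim: n => [|n IH].
  by under eq_fun do rewrite expr0; exact: lipschitz_along_cst.
by under eq_fun do rewrite exprS; exact: lipschitz_alongM.
Qed.

Lemma lipschitz_along_norm f : lipschitz_along w f ->
  lipschitz_along w (fun p => `|f p|).
Proof.
apply: lipschitz_along_le; exists 1 => // p q; rewrite mul1r.
exact: ler_dist_dist.
Qed.

Lemma lipschitz_along_max f g : lipschitz_along w f -> lipschitz_along w g ->
  lipschitz_along w (fun p => Num.max (f p) (g p)).
Proof.
move=> lf lg; under eq_fun do rewrite maxr_absE mulrC.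
apply: lipschitz_alongZ; apply: lipschitz_alongD; first exact: lipschitz_alongD.
by apply: lipschitz_along_norm; exact: lipschitz_alongB.
Qed.

Lemma lipschitz_along_bounded f (r : R) : lipschitz_along w f ->
  exists M, forall p, `|p| <= r -> `|f p| <= M.
Proof.
move=> /(_ r)[L _ fL]; exists L => p pr.
by have [] := fL p 1 pr; rewrite ?ltr01 ?lexx.
Qed.

End lipschitz_along_theory.

Section integration_by_parts.
Variable R : realType.

(** The product [F * phi] has compact support and is Lipschitz along [w], so the
integral of its derivative vanishes. *)
Lemma compact_support_ibp (w : R * R) (F G phi dphi : R * R -> R) (r : R) :
  `|w| <= 1 ->
  lipschitz_along w F -> lipschitz_along w phi ->
  continuous F -> continuous phi -> continuous dphi ->
  measurable_fun setT (G : plane R -> measurableTypeR R) ->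
  (forall p, r < `|p| -> phi p = 0) ->
  (forall p, is_derive p w phi (dphi p)) ->
  {ae mu2 R, forall p : plane R, is_derive (p : R * R) w F (G p)} ->
  (mu2 R).-integrable setT (EFin \o (fun p => F p * dphi p)) ->
  (mu2 R).-integrable setT (EFin \o (fun p => G p * phi p)) /\
  \int[mu2 R]_p (F p * dphi p) = - \int[mu2 R]_p (G p * phi p).
Proof.
move=> w1 lF lphi cF cphi cdphi mG phir dphiE dF iFd.
pose H p := F p * phi p; pose h p := F p * dphi p + G p * phi p.
have [L L0 HL] : exists2 L, 0 <= L & forall (p : R * R) (t : R), `|p| <= r + 1 ->
    0 < t <= 1 -> `|H p| <= L /\ `|H (p + t *: w) - H p| <= L * t.
  exact: (lipschitz_alongM lF lphi).
have mF := continuous_measurable_plane cF.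
have mphi := continuous_measurable_plane cphi.
have mdphi := continuous_measurable_plane cdphi.
have Hr p : r < `|p| -> H p = 0 by move=> rp; rewrite /H phir ?mulr0.
have [||||||ih h0] := @integral_derive_eq0 R H h w L L r w1.
- exact: measurable_funM.
- by apply: measurable_funD; exact: measurable_funM.
- move=> p; have [pr|pr] := lerP `|p| (r + 1).
    by have [] := HL p 1 pr; rewrite ?ltr01 ?lexx.
  by rewrite Hr ?normr0 //; apply: lt_trans pr; rewrite ltrDl.
- exact: Hr.
- move=> p t t01; have [pr|pr] := lerP `|p| (r + 1).
    by have [] := HL p t pr t01.
  have /andP[t0 t1] := t01.
  rewrite !Hr ?subrr ?normr0; first by rewrite mulr_ge0 // ltW.
    by apply: lt_trans pr; rewrite ltrDl.
  have : `|p| <= `|p + t *: w| + `|t *: w|.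
    by rewrite -[X in `|X| <= _](addrK (t *: w)) ler_normB.
  have : `|t *: w| <= 1 by rewrite normrZ gtr0_norm // mulr_ile1 // ltW.
  lra.
- apply: filterS dF => p dFp.
  have E : is_derive (p : R * R) w (H : R * R -> R) (F p *: dphi p + phi p *: G p).
    exact: is_deriveM dFp (dphiE p).
  by apply: is_derive_eq E _; rewrite /h /GRing.scale /= (mulrC (phi p)).
have iG : (mu2 R).-integrable setT (EFin \o (fun p => G p * phi p)).
  have := integrableB measurableT ih iFd.
  apply: eq_integrable => // p _; rewrite /= -EFinB /h; congr EFin; ring.
split => //.
move: h0; rewrite /h RintegralD // => /eqP; rewrite addr_eq0 => /eqP //.
Qed.

End integration_by_parts.

(** * Restriction to lines and symmetry of second derivatives *)

Section along_lines.
Variable R : realType.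
Implicit Types (f : R * R -> R) (p w : R * R).

Lemma is_derive_line f p w (t d : R) : is_derive (p + t *: w) w f d ->
  is_derive t (1 : R) (fun s : R => f (p + s *: w)) d.
Proof.
move=> [df <-].
have E : (fun h : R => h^-1 *: (((fun s : R => f (p + s *: w)) \o shift t) (h *: (1 : R))
      - f (p + t *: w))) =
    (fun h : R => h^-1 *: ((f \o shift (p + t *: w)) (h *: w) - f (p + t *: w))).
  apply/funext => h /=; congr (_ *: (f _ - _)).
  have -> : h *: (1 : R) = h by exact: mulr1.
  by rewrite scalerDl addrCA.
by apply: DeriveDef; rewrite /derivable /derive E.
Qed.

Lemma MVT_line f (df : R * R -> R) p w (t : R) : 0 < t ->
  (forall s, is_derive (p + s *: w) w f (df (p + s *: w))) ->
  exists2 s, 0 <= s <= t & f (p + t *: w) - f p = df (p + s *: w) * t.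
Proof.
move=> t0 dfE.
have dg (s : R) : is_derive s (1 : R) (fun s : R => f (p + s *: w)) (df (p + s *: w)).
  exact: is_derive_line.
have [|s] := @MVT R (fun s => f (p + s *: w)) (fun s => df (p + s *: w)) 0 t t0
  (fun s _ => dg s).
  apply: continuous_subspaceT => s.
  have [ds _] := dg s.
  by apply: differentiable_continuous; apply/derivable1_diffP.
rewrite in_itv /= => /andP[s0 st]; rewrite scale0r addr0 subr0 => E.
by exists s => //; rewrite !ltW.
Qed.

Lemma bounded_derive_lipschitz_along f (df : R * R -> R) w (M N : R) :
  (forall p, is_derive p w f (df p)) -> (forall p, `|f p| <= M) ->
  (forall p, `|df p| <= N) -> lipschitz_along w f.
Proof.
move=> dfE fM dfN r.
have M0 : 0 <= M by apply: le_trans (fM 0).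
have N0 : 0 <= N by apply: le_trans (dfN 0).
exists (M + N) => [|p t pr /andP[t0 t1]]; first exact: addr_ge0.
split; first by apply: le_trans (fM p) _; rewrite lerDl.
have [s _ ->] := MVT_line t0 (fun s => dfE (p + s *: w)).
rewrite normrM (gtr0_norm t0) ler_pM2r //.
by apply: le_trans (dfN _) _; rewrite lerDr.
Qed.

(** Two applications of the mean value theorem.  The left-hand side is symmetric
in [u] and [v], which is what makes the mixed derivatives agree. *)
Lemma second_difference f (f1 f2 : R * R -> R) (u v : R * R) (p : R * R) (h : R) :
  0 < h -> (forall q, is_derive q u f (f1 q)) -> (forall q, is_derive q v f1 (f2 q)) ->
  exists s t, [/\ 0 <= s <= h, 0 <= t <= h &
    f (p + h *: u + h *: v) - f (p + h *: u) - f (p + h *: v) + f p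
    = f2 (p + s *: u + t *: v) * (h * h)].
Proof.
move=> h0 d1 d2.
pose g q := f (q + h *: v) - f q.
have dg q : is_derive q u g (f1 (q + h *: v) - f1 q).
  apply: is_deriveB.
  have [df <-] := d1 (q + h *: v).
  have E : (fun k : R => k^-1 *: (((fun x => f (x + h *: v)) \o shift q) (k *: u)
      - f (q + h *: v))) =
    (fun k : R => k^-1 *: ((f \o shift (q + h *: v)) (k *: u) - f (q + h *: v))).
    by apply/funext => k /=; rewrite addrA.
  by apply: DeriveDef; rewrite /derivable /derive E.
have [s sh gE] := MVT_line (df := fun q => f1 (q + h *: v) - f1 q)
  (p := p) h0 (fun s => dg (p + s *: u)).
have [t th fE] := MVT_line (df := f2) (p := p + s *: u) h0
  (fun t => d2 (p + s *: u + t *: v)).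
exists s, t; split => //.
rewrite mulrA -fE -gE /g (addrAC p); ring.
Qed.

(** Both mixed derivatives are values of the same second difference, at points
that tend to [p] with [h]. *)
Lemma mixed_derivatives f (fu fv fuv fvu : R * R -> R) (u v p : R * R) :
  (forall q, is_derive q u f (fu q)) -> (forall q, is_derive q v f (fv q)) ->
  (forall q, is_derive q v fu (fuv q)) -> (forall q, is_derive q u fv (fvu q)) ->
  {for p, continuous fuv} -> {for p, continuous fvu} -> fuv p = fvu p.
Proof.
move=> du dv duv dvu cuv cvu; apply/eqP; rewrite -subr_eq0 -normr_le0.
apply/ler_addgt0Pr => e e0; rewrite add0r.
have e2 : 0 < e / 2 by rewrite divr_gt0.
have /cvgr_dist_le /(_ _ e2) /nbhs_normP [d1 /= d10 D1] := cuv.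
have /cvgr_dist_le /(_ _ e2) /nbhs_normP [d2 /= d20 D2] := cvu.
(* The step [h] keeps every intermediate point in the balls where both mixed
   derivatives vary by at most [e / 2]. *)
pose K := `|u| + `|v| + 1.
have K0 : 0 < K by rewrite ltr_wpDl // addr_ge0.
pose h := Num.min d1 d2 / (2 * K).
have m0 : 0 < Num.min d1 d2 by rewrite lt_min d10 d20.
have h0 : 0 < h by rewrite divr_gt0 // mulr_gt0.
have small (a b : R) (x y : R * R) : `|x| + `|y| <= K -> 0 <= a <= h -> 0 <= b <= h ->
    `|p - (p + a *: x + b *: y)| < Num.min d1 d2.
  move=> xy /andP[a0 ah] /andP[b0 bh].
  rewrite -addrA opprD addNKr normrN.
  apply: le_lt_trans (ler_normD _ _) _; rewrite !normrZ !ger0_norm //.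
  have hK : h * K < Num.min d1 d2.
    have -> : h * K = Num.min d1 d2 / 2 by rewrite /h; field; rewrite gt_eqF.
    lra.
  have h1 : a * `|x| <= h * `|x| by rewrite ler_wpM2r.
  have h2 : b * `|y| <= h * `|y| by rewrite ler_wpM2r.
  have h3 : h * (`|x| + `|y|) <= h * K by rewrite ler_wpM2l // ltW.
  lra.
have uvK : `|u| + `|v| <= K by rewrite /K lerDl.
have vuK : `|v| + `|u| <= K by rewrite addrC.
have [s [t [sh th E1]]] := second_difference p h0 du duv.
have [s' [t' [sh' th' E2]]] := second_difference p h0 dv dvu.
have E : fuv (p + s *: u + t *: v) = fvu (p + s' *: v + t' *: u).
  have hh : h * h != 0 by rewrite mulf_neq0 // gt_eqF.
  apply: (mulIf hh); rewrite -E1 -E2 (addrAC p); ring.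
have := small _ _ _ _ uvK sh th; rewrite lt_min => /andP[/D1 A1 _].
have := small _ _ _ _ vuK sh' th'; rewrite lt_min => /andP[_ /D2 A2].
rewrite /= in A1 A2.
have -> : fuv p - fvu p = (fuv p - fuv (p + s *: u + t *: v)) -
   (fvu p - fvu (p + s' *: v + t' *: u)) by rewrite E; ring.
apply: le_trans (ler_normB _ _) _; lra.
Qed.

End along_lines.

(** * Test functions and weak derivatives *)

Section test_functions.
Variables (R : realType) (U : set (R * R)).
Implicit Types phi : R * R -> R.

Lemma test_function_continuous phi : test_function U phi -> continuous phi.
Proof. by move=> [/(_ 0%N) [] ]. Qed.

Lemma test_function_partial phi (i : 'I_2) : test_function U phi ->
  test_function U (partial i phi).
Proof.
move=> [Cphi cphi sphi].
have sub : closure [set p | partial i phi p != 0] `<=` closure [set p | phi p != 0].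
  apply: (subset_trans _ (@closed_closure _ [set p | phi p != 0])).
  apply: closure_subset => p /= dp; apply: contrapT => np.
  move/eqP: dp; apply; rewrite /partial.
  have : \forall q \near p, phi q = (cst 0 : R * R -> R) q.
    have : nbhs p (~` closure [set p | phi p != 0]).
      by apply: open_nbhs_nbhs; split => //; apply/closed_openC/closed_closure.
    apply: filterS => q nq; apply/eqP; apply: contrapT => /negP h.
    by apply: nq; exact: subset_closure.
  by move=> /(near_eq_derive (axis R i)) ->; exact: derive_cst.
split.
- by move=> n; have [_ /(_ i) []] := Cphi n.+1.
- by apply: subclosed_compact sub; [exact: closed_closure|].
- exact: subset_trans sub sphi.
Qed.

Lemma test_function_is_derive phi (i : 'I_2) p : test_function U phi ->
  is_derive p (axis R i) phi (partial i phi p).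
Proof.
move=> [/(_ 1%N) [_ /(_ i) [+ _]] _ _] => /(_ p) dp; exact/derivableP.
Qed.

Lemma test_function_support phi : test_function U phi ->
  exists2 r, 0 <= r & forall p, r < `|p| -> phi p = 0.
Proof.
move=> [_ /compact_bounded [M [_ MP]] _].
exists (`|M| + 1) => [|p Mp]; first by rewrite addr_ge0.
apply/eqP; apply: contrapT => /negP h.
have : `|p| <= `|M| + 1.
  apply: (MP (`|M| + 1)); first by rewrite (le_lt_trans (ler_norm _)) // ltrDl.
  exact: subset_closure.
lra.
Qed.

Lemma test_function_bounded phi : test_function U phi ->
  exists M, forall p, `|phi p| <= M.
Proof.
move=> tphi; have [_ cphi _] := tphi.
have /compact_bounded [M [_ MP]] : compact (phi @` closure [set p | phi p != 0]).
  apply: continuous_compact => //; apply: continuous_subspaceT.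
  exact: test_function_continuous.
exists (`|M| + 1) => p.
have [->|h] := eqVneq (phi p) 0; first by rewrite normr0 addr_ge0.
apply: (MP (`|M| + 1)); first by rewrite (le_lt_trans (ler_norm _)) // ltrDl.
by exists p => //; exact: subset_closure.
Qed.

Lemma test_function_eq0 phi p : test_function U phi -> ~ U p -> phi p = 0.
Proof.
move=> [_ _ sU] nU; apply/eqP; apply: contrapT => /negP h.
by apply: nU; apply: sU; exact: subset_closure.
Qed.

Lemma test_function_lipschitz_along phi i : test_function U phi ->
  lipschitz_along (axis R i) phi.
Proof.
move=> tphi; have [M phiM] := test_function_bounded tphi.
have [N phiN] := test_function_bounded (test_function_partial i tphi).
apply: (bounded_derive_lipschitz_along _ phiM phiN) => p.
exact: test_function_is_derive.
Qed.

Lemma test_function_partialC phi i j : test_function U phi ->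
  partial i (partial j phi) = partial j (partial i phi).
Proof.
move=> tphi; apply/funext => p.
have ti := test_function_partial i tphi.
have tj := test_function_partial j tphi.
apply: (@mixed_derivatives R phi (partial j phi) (partial i phi)
   _ _ (axis R j) (axis R i)) => [q|q|q|q||].
- exact: test_function_is_derive.
- exact: test_function_is_derive.
- exact: test_function_is_derive.
- exact: test_function_is_derive.
- by apply: test_function_continuous; exact: test_function_partial.
- by apply: test_function_continuous; exact: test_function_partial.
Qed.

Lemma norm_axis (i : 'I_2) : `|axis R i| <= 1.
Proof.
by rewrite /axis /Num.norm /= ge_max; case: (i == 0); case: (i == 1);
  rewrite ?normr0 ?normr1 ?lexx ?ler01.
Qed.

Lemma test_function_integrable_mul (F : R * R -> R) phi i :
  test_function U phi -> lipschitz_along (axis R i) F ->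
  measurable_fun setT (F : plane R -> measurableTypeR R) ->
  (mu2 R).-integrable setT (EFin \o (fun p => F p * phi p)).
Proof.
move=> tphi lF mF.
have [r r0 phir] := test_function_support tphi.
have [M phiM] := test_function_bounded tphi.
have M0 : 0 <= M by apply: le_trans (phiM 0).
have [L L0 FL] := lF r.
apply: (compact_support_integrable (M := L * M) (r := r)).
- apply: measurable_funM => //.
  exact: continuous_measurable_plane (test_function_continuous tphi).
- move=> p; have [pr|pr] := lerP `|p| r.
    have [|F1 _] := FL p 1 pr; first by rewrite ltr01 lexx.
    by rewrite normrM ler_pM.
  by rewrite phir // mulr0 normr0 mulr_ge0.
- by move=> p pr; rewrite phir ?mulr0.
Qed.

(** A test function and its partial derivatives are bounded with compact support,
which provides the integrability that [compact_support_ibp] asks for. *)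
Lemma weak_derivative_plane (F G : R * R -> R) (i : 'I_2) phi :
  test_function U phi ->
  lipschitz_along (axis R i) F -> continuous F ->
  measurable_fun setT (G : plane R -> measurableTypeR R) ->
  {ae mu2 R, forall p : plane R, is_derive (p : R * R) (axis R i) F (G p)} ->
  (mu2 R).-integrable setT (EFin \o (fun p => G p * phi p)) /\
  \int[mu2 R]_p (F p * partial i phi p) = - \int[mu2 R]_p (G p * phi p).
Proof.
move=> tphi lF cF mG dF.
have [r r0 phir] := test_function_support tphi.
have tiphi := test_function_partial i tphi.
apply: (@compact_support_ibp R (axis R i) F G phi (partial i phi) r) => //.
- exact: norm_axis.
- exact: test_function_lipschitz_along.
- exact: test_function_continuous.
- exact: test_function_continuous.
- by move=> p; exact: test_function_is_derive.
- apply: (test_function_integrable_mul tiphi lF).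
  exact: continuous_measurable_plane.
Qed.

End test_functions.

(** * The potential on the whole plane *)

Definition ramp (R : realType) (n : nat) (u : R) : R := if 0 < u then u ^+ n else 0.

Section derivative_of_glued_functions.
Variables (R : realType) (V : normedModType R).
Implicit Types (f g : V -> R) (p w : V).

Lemma is_derive_cvg f p w (d : R) : is_derive p w f d <->
  ((fun h => h^-1 *: ((f \o shift p) (h *: w) - f p)) @ 0^' --> d).
Proof.
split=> [[df <-] //|df].
by apply: DeriveDef; [apply: cvgP df|exact: cvg_lim df].
Qed.

(** Each difference quotient of [f] is one of [f1] or of [f2], and both converge
to [d]. *)
Lemma is_derive_select f f1 f2 p w (d : R) :
  is_derive p w f1 d -> is_derive p w f2 d -> f p = f1 p -> f p = f2 p ->
  (forall q, f q = f1 q \/ f q = f2 q) -> is_derive p w f d.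
Proof.
move=> /is_derive_cvg/cvgrPdist_le d1 /is_derive_cvg/cvgrPdist_le d2 E1 E2 sel.
apply/is_derive_cvg/cvgrPdist_le => e e0.
have := d1 e e0; have := d2 e e0; apply: filterS2 => h h2 h1 /=.
by have [/= ->|/= ->] := sel (h *: w + p); [rewrite E1|rewrite E2].
Qed.

Lemma ramp_max n (u : R) : ramp n.+1 u = Num.max u 0 ^+ n.+1.
Proof.
by rewrite /ramp; case: ltP => // _; rewrite expr0n.
Qed.

(** Where [f p] is zero the power and the zero function are glued, and their
derivatives agree only if [2 <= n]. *)
Lemma is_derive_ramp n f p w (d : R) : {for p, continuous f} ->
  f p != 0 \/ (2 <= n)%N -> is_derive p w f d ->
  is_derive p w (fun q => ramp n (f q)) (n%:R * ramp n.-1 (f p) * d).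
Proof.
move=> cf fn df.
have dX : is_derive p w (fun q => f q ^+ n) (n%:R * f p ^+ n.-1 * d).
  have -> : (fun q => f q ^+ n) = f ^+ n by rewrite exprfctE.
  exact: is_deriveX.
have d0 : is_derive p w (fun=> 0 : R) 0 by exact: is_derive_cst.
have [fp|fp|fp] := ltgtP (f p) 0.
- rewrite /ramp ltNge (ltW fp) /= mulr0 mul0r.
  apply: near_eq_is_derive d0; near=> q.
  by rewrite ltNge (ltW (y := 0)) //; near: q; exact: cvgr_lt cf _ fp.
- rewrite [X in _ * X * _]/ramp fp.
  apply: near_eq_is_derive dX; near=> q.
  by rewrite /ramp ifT //; near: q; exact: cvgr_gt cf _ fp.
- case: fn => [|n2]; first by rewrite fp eqxx.
  have [m nE] : exists m, n = m.+2 by case: n n2 {dX} => [|[|m]] // _; exists m.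
  have r0 j : ramp j (f p) = 0 by rewrite /ramp fp ltxx.
  rewrite r0 mulr0 mul0r.
  apply: (is_derive_select (f1 := fun q => f q ^+ n) (f2 := fun=> 0)) => //.
  + by apply: is_derive_eq dX _; rewrite fp nE /= expr0n mulr0 mul0r.
  + by rewrite r0 fp nE expr0n.
  + by move=> q; rewrite /ramp; case: ifP; [left|right].
Unshelve. all: by end_near. Qed.

End derivative_of_glued_functions.

Section affine_functions.
Variables (R : realType) (a b c : R).
Let X (p : R * R) : R := a * p.1 + b * p.2 + c.

Lemma continuous_affine : continuous X.
Proof.
move=> p; rewrite /continuous_at /X; apply: cvgD; last exact: cvg_cst.
apply: cvgD; (apply: cvgM; first exact: cvg_cst).
- exact: cvg_fst.
- exact: cvg_snd.
Qed.

Lemma is_derive_affine (p w : R * R) : is_derive p w X (a * w.1 + b * w.2).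
Proof.
apply/is_derive_cvg.
apply: cvg_trans (cvg_cst (a * w.1 + b * w.2)).
apply: near_eq_cvg; apply: filterS (nbhs_dnbhs_neq _) => h h0.
rewrite /X /= -[h *: w.1]/(h * w.1) -[h *: w.2]/(h * w.2) -[RHS]/(_ * _).
by field.
Unshelve. all: exact: dnbhs_filter. Qed.

End affine_functions.


Section products.
Variables (R : realType) (p w : R * R).
Implicit Types f g : R * R -> R.

Lemma is_derive_mul f g (df dg : R) : is_derive p w f df -> is_derive p w g dg ->
  is_derive p w (fun q => f q * g q) (df * g p + f p * dg).
Proof.
move=> f' g'.
have fg : is_derive p w (fun q => f q * g q) (f p *: dg + g p *: df).
  exact: is_deriveM.
by apply: is_derive_eq fg _; rewrite addrC [X in X + _ = _]mulrC.
Qed.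

Lemma is_derive_add f g (df dg : R) : is_derive p w f df -> is_derive p w g dg ->
  is_derive p w (fun q => f q + g q) (df + dg).
Proof. exact: is_deriveD. Qed.

Lemma is_derive_sub f g (df dg : R) : is_derive p w f df -> is_derive p w g dg ->
  is_derive p w (fun q => f q - g q) (df - dg).
Proof. exact: is_deriveB. Qed.

Lemma is_derive_scale f (c df : R) : is_derive p w f df ->
  is_derive p w (fun q => c * f q) (c * df).
Proof. exact: is_deriveZ. Qed.

End products.

Lemma continuous_max (R : realType) (f g : R * R -> R) : continuous f -> continuous g ->
  continuous (fun p => Num.max (f p) (g p)).
Proof.
move=> cf cg p; under eq_fun do rewrite maxr_absE.
rewrite /continuous_at.
apply: cvgM; last exact: cvg_cst.
apply: cvgD; first by apply: cvgD; [exact: cf|exact: cg].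
by apply: cvg_norm; apply: cvgB; [exact: cf|exact: cg].
Qed.

Lemma measurable_ramp (R : realType) n :
  measurable_fun [set: measurableTypeR R] (@ramp R n : _ -> measurableTypeR R).
Proof.
apply: measurable_fun_ifT => //.
  by apply: measurable_fun_ltr.
Qed.

Section potential.
Variables (R : realType) (x1 x2 x0 y1 y2 y0 : R) (k : nat).
Let X (p : R * R) : R := x1 * p.1 + x2 * p.2 + x0.
Let Y (p : R * R) : R := y1 * p.1 + y2 * p.2 + y0.
Let dX (w : R * R) : R := x1 * w.1 + x2 * w.2.
Let dY (w : R * R) : R := y1 * w.1 + y2 * w.2.

(** Up to a factor, the extension of v_0 to the plane; [X] and [Y] stand for
lambda_0 - lambda_1 and lambda_0 - lambda_2. *)
Definition potential (p : R * R) : R :=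
  ramp k.+1 (Num.max (X p) (Y p)) * (X p - Y p).

(** Derivative of [potential] along [w].  It is written with maxima, rather than by
cases on [X p] and [Y p], to make its continuity evident. *)
Definition potential_deriv (w p : R * R) : R :=
  k.+1%:R * ramp k (Num.max (X p) (Y p)) *
    (dX w * Num.max (X p - Y p) 0 - dY w * Num.max (Y p - X p) 0)
  + ramp k.+1 (Num.max (X p) (Y p)) * (dX w - dY w).

(** Derivative of [potential_deriv w] along [v], off the lines [X = 0], [Y = 0]
and [X = Y]. *)
Definition potential_deriv2 (w v p : R * R) : R :=
  if Y p < X p then
    k.+1%:R * (k%:R * ramp k.-1 (X p) * dX v * dX w * (X p - Y p)
      + ramp k (X p) * (dX w * (dX v - dY v) + dX v * (dX w - dY w)))
  else
    k.+1%:R * (k%:R * ramp k.-1 (Y p) * dY v * dY w * (X p - Y p)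
      + ramp k (Y p) * (dY w * (dX v - dY v) + dY v * (dX w - dY w))).

Let cX : continuous X. Proof. exact: continuous_affine. Qed.
Let cY : continuous Y. Proof. exact: continuous_affine. Qed.

Let near_gt (f g : R * R -> R) p : continuous f -> continuous g -> g p < f p ->
  \forall q \near p, g q < f q.
Proof.
move=> cf cg gf.
have cfg : (fun q => f q - g q) @ p --> f p - g p.
  by apply: cvgB; [exact: cf|exact: cg].
have : \forall q \near p, 0 < f q - g q by apply: cvgr_gt cfg _ _; rewrite subr_gt0.
by apply: filterS => q; rewrite subr_gt0.
Qed.

(** On the line [X = Y] the potential is glued from two functions whose derivatives
at [p] differ by a multiple of [X p - Y p]. *)
Lemma potential_is_derive p w : (0 < k)%N ->
  is_derive p w potential (potential_deriv w p).
Proof.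
move=> k0.
have dXY : is_derive p w (fun q => X q - Y q) (dX w - dY w).
  by apply: is_derive_sub; exact: is_derive_affine.
have piece (Z : R * R -> R) (dZ : R) : continuous Z -> is_derive p w Z dZ ->
  is_derive p w (fun q => ramp k.+1 (Z q) * (X q - Y q))
    (k.+1%:R * ramp k (Z p) * dZ * (X p - Y p) + ramp k.+1 (Z p) * (dX w - dY w)).
  move=> cZ dZp; apply: is_derive_mul => //.
  by apply: (@is_derive_ramp _ _ k.+1) => //; [exact: cZ|right].
have pX := piece X (dX w) cX (is_derive_affine _ _ _ _ _).
have pY := piece Y (dY w) cY (is_derive_affine _ _ _ _ _).
have [XY|YX|XY] := ltgtP (X p) (Y p).
- have H : is_derive p w potential
      (k.+1%:R * ramp k (Y p) * dY w * (X p - Y p) + ramp k.+1 (Y p) * (dX w - dY w)).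
    apply: near_eq_is_derive pY; apply: filterS (near_gt cY cX XY) => q XYq.
    by rewrite /potential maxEle (ltW XYq).
  apply: is_derive_eq H _; rewrite /potential_deriv maxEle (ltW XY).
  rewrite [Num.max (X p - _) _]max_r ?subr_le0 ?(ltW XY) //.
  rewrite [Num.max (Y p - _) _]max_l ?subr_ge0 ?(ltW XY) //; ring.
- have H : is_derive p w potential
      (k.+1%:R * ramp k (X p) * dX w * (X p - Y p) + ramp k.+1 (X p) * (dX w - dY w)).
    apply: near_eq_is_derive pX; apply: filterS (near_gt cX cY YX) => q YXq.
    by rewrite /potential maxEge (ltW YXq).
  apply: is_derive_eq H _; rewrite /potential_deriv maxEge (ltW YX).
  rewrite [Num.max (Y p - _) _]max_r ?subr_le0 ?(ltW YX) //.
  rewrite [Num.max (X p - _) _]max_l ?subr_ge0 ?(ltW YX) //; ring.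
- apply: (is_derive_select (f1 := fun q => ramp k.+1 (X q) * (X q - Y q))
    (f2 := fun q => ramp k.+1 (Y q) * (X q - Y q))).
  + apply: is_derive_eq pX _; rewrite /potential_deriv XY !subrr !maxxx.
    by rewrite !mulr0 subrr mulr0.
  + apply: is_derive_eq pY _; rewrite /potential_deriv XY !subrr !maxxx.
    by rewrite !mulr0 subrr mulr0.
  + by rewrite /potential XY maxxx.
  + by rewrite /potential XY maxxx.
  + by move=> q; rewrite /potential maxEle; case: ifP; [right|left].
Qed.

Lemma potential_deriv_is_derive p w v : (0 < k)%N ->
  X p != 0 -> Y p != 0 -> X p != Y p ->
  is_derive p v (potential_deriv w) (potential_deriv2 w v p).
Proof.
move=> k0 X0 Y0 XY0.
have dXv : is_derive p v X (dX v) by exact: is_derive_affine.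
have dYv : is_derive p v Y (dY v) by exact: is_derive_affine.
have dXY : is_derive p v (fun q => X q - Y q) (dX v - dY v) by exact: is_derive_sub.
have piece (Z : R * R -> R) (dZv dZw : R) :
  continuous Z -> is_derive p v Z dZv -> Z p != 0 ->
  is_derive p v (fun q => k.+1%:R * (ramp k (Z q) * (dZw * (X q - Y q)))
      + ramp k.+1 (Z q) * (dX w - dY w))
    (k.+1%:R * (k%:R * ramp k.-1 (Z p) * dZv * dZw * (X p - Y p)
      + ramp k (Z p) * (dZw * (dX v - dY v) + dZv * (dX w - dY w)))).
  move=> cZ dZp Z0.
  have r1 : is_derive p v (fun q => ramp k (Z q)) (k%:R * ramp k.-1 (Z p) * dZv).
    by apply: is_derive_ramp => //; [exact: cZ|left].
  have r2 : is_derive p v (fun q => ramp k.+1 (Z q)) (k.+1%:R * ramp k (Z p) * dZv).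
    by apply: (@is_derive_ramp _ _ k.+1) => //; [exact: cZ|left].
  have c0 : is_derive p v (fun=> dX w - dY w : R) 0 by exact: is_derive_cst.
  apply: is_derive_eq (is_derive_add (is_derive_scale k.+1%:R
    (is_derive_mul r1 (is_derive_scale dZw dXY))) (is_derive_mul r2 c0)) _.
  by ring.
have [XY|YX|XY] := ltgtP (X p) (Y p); last by rewrite XY eqxx in XY0.
- have := piece Y (dY v) (dY w) cY dYv Y0.
  rewrite /potential_deriv2 ltNge (ltW XY) /=.
  apply: near_eq_is_derive; apply: filterS (near_gt cY cX XY) => q XYq.
  rewrite /potential_deriv maxEle (ltW XYq).
  rewrite [Num.max (X q - _) _]max_r ?subr_le0 ?(ltW XYq) //.
  rewrite [Num.max (Y q - _) _]max_l ?subr_ge0 ?(ltW XYq) //; ring.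
- have := piece X (dX v) (dX w) cX dXv X0.
  rewrite /potential_deriv2 YX.
  apply: near_eq_is_derive; apply: filterS (near_gt cX cY YX) => q YXq.
  rewrite /potential_deriv maxEge (ltW YXq).
  rewrite [Num.max (Y q - _) _]max_r ?subr_le0 ?(ltW YXq) //.
  rewrite [Num.max (X q - _) _]max_l ?subr_ge0 ?(ltW YXq) //; ring.
Qed.

Let lip_ramp u n (f : R * R -> R) : lipschitz_along u f ->
  lipschitz_along u (fun p => ramp n.+1 (f p)).
Proof.
move=> lf; under eq_fun do rewrite ramp_max.
by apply: lipschitz_alongX; apply: lipschitz_along_max => //; exact: lipschitz_along_cst.
Qed.

Let cont_ramp n (f : R * R -> R) : continuous f ->
  continuous (fun p => ramp n.+1 (f p)).
Proof.
move=> cf; have -> : (fun p => ramp n.+1 (f p)) =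
    (fun u : R => u ^+ n.+1) \o (fun p => Num.max (f p) 0).
  by apply/funext => p; rewrite ramp_max.
move=> p; apply: continuous_comp; last exact: exprn_continuous.
by apply: (continuous_max (g := fun=> 0) cf) => q; exact: cvg_cst.
Qed.

Let lX u : lipschitz_along u X. Proof. exact: lipschitz_along_affine. Qed.
Let lY u : lipschitz_along u Y. Proof. exact: lipschitz_along_affine. Qed.

Lemma potential_lipschitz u : lipschitz_along u potential.
Proof.
apply: lipschitz_alongM; last exact: lipschitz_alongB.
by apply: lip_ramp; exact: lipschitz_along_max.
Qed.

Lemma potential_continuous : continuous potential.
Proof.
move=> p; apply: cvgM; last by apply: cvgB; [exact: cX|exact: cY].
exact: (cont_ramp (continuous_max cX cY)).
Qed.

Lemma potential_deriv_lipschitz u w : (0 < k)%N ->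
  lipschitz_along u (potential_deriv w).
Proof.
move=> k0; rewrite /potential_deriv; case: k k0 => // k' _.
have lM : lipschitz_along u (fun p => Num.max (X p) (Y p)) by exact: lipschitz_along_max.
have l0 : lipschitz_along u (fun=> 0) by exact: lipschitz_along_cst.
apply: lipschitz_alongD; apply: lipschitz_alongM.
- by apply: lipschitz_alongZ; exact: lip_ramp.
- by apply: lipschitz_alongB; apply: lipschitz_alongZ;
    apply: lipschitz_along_max => //; exact: lipschitz_alongB.
- exact: lip_ramp.
- exact: lipschitz_along_cst.
Qed.

Lemma potential_deriv_continuous w : (0 < k)%N -> continuous (potential_deriv w).
Proof.
move=> k0; rewrite /potential_deriv; case: k k0 => // k' _ p.
have cM := continuous_max cX cY.
have c0 : continuous (fun _ : R * R => 0 : R) by move=> q; exact: cvg_cst.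
have cXY : continuous (fun q => X q - Y q).
  by move=> q; apply: cvgB; [exact: cX|exact: cY].
have cYX : continuous (fun q => Y q - X q).
  by move=> q; apply: cvgB; [exact: cY|exact: cX].
apply: cvgD; apply: cvgM.
- by apply: cvgM; [exact: cvg_cst|exact: (cont_ramp cM)].
- apply: cvgB; apply: cvgM; try exact: cvg_cst.
    exact: (continuous_max cXY c0).
  exact: (continuous_max cYX c0).
- exact: (cont_ramp cM).
- exact: cvg_cst.
Qed.

Lemma potential_deriv2_measurable w v :
  measurable_fun setT (potential_deriv2 w v : plane R -> measurableTypeR R).
Proof.
have mX : measurable_fun setT (X : plane R -> measurableTypeR R).
  exact: measurable_affine.
have mY : measurable_fun setT (Y : plane R -> measurableTypeR R).
  exact: measurable_affine.
have mr n (f : plane R -> measurableTypeR R) : measurable_fun setT f ->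
    measurable_fun setT (fun p => ramp n (f p) : measurableTypeR R).
  by move=> mf; apply: measurableT_comp => //; exact: measurable_ramp.
have mXY : measurable_fun setT (fun p : plane R => X p - Y p : measurableTypeR R).
  exact: measurable_funB.
apply: measurable_fun_ifT.
- exact: measurable_fun_ltr.
- apply: measurable_funM => //; apply: measurable_funD; apply: measurable_funM => //;
    try exact: mr.
  by do 2 apply: measurable_funM => //; apply: measurable_funM => //; exact: mr.
- apply: measurable_funM => //; apply: measurable_funD; apply: measurable_funM => //;
    try exact: mr.
  by do 2 apply: measurable_funM => //; apply: measurable_funM => //; exact: mr.
Qed.

End potential.

(** * Barycentric coordinates and refined hat functions *)

Lemma ord2P (P : 'I_2 -> Prop) : P 0 -> P 1 -> forall i, P i.
Proof.
move=> P0 P1 [[|[|//]] i2].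
- by rewrite (_ : Ordinal i2 = 0) //; exact: val_inj.
- by rewrite (_ : Ordinal i2 = 1) //; exact: val_inj.
Qed.

Lemma ord3P (P : 'I_3 -> Prop) : P 0 -> P 1 -> P 2 -> forall i, P i.
Proof.
move=> P0 P1 P2 [[|[|[|//]]] i3].
- by rewrite (_ : Ordinal i3 = 0) //; exact: val_inj.
- by rewrite (_ : Ordinal i3 = 1) //; exact: val_inj.
- by rewrite (_ : Ordinal i3 = 2) //; exact: val_inj.
Qed.

Lemma sum_ord3 (V : nmodType) (F : 'I_3 -> V) : \sum_i F i = F 0 + F 1 + F 2.
Proof.
rewrite !big_ord_recl big_ord0 addr0 addrA; congr (_ + _ + _); congr F; exact: val_inj.
Qed.

Lemma plane_eq (R : realType) (p q : R * R) : p.1 = q.1 -> p.2 = q.2 -> p = q.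
Proof. by case: p q => [? ?] [? ?] /= -> ->. Qed.

(** An affine function is the combination of its vertex values [A] by the
barycentric coordinates [l]; its value at the vertex opposite to the subtriangle
is determined by its vanishing at the barycenter. *)
Lemma hat_values (R : realType) (j i : 'I_3) (l A : 'I_3 -> R) :
  (forall m, m != j -> A m = (m == i)%:R) -> A 0 + A 1 + A 2 = 0 ->
  l 0 * A 0 + l 1 * A 1 + l 2 * A 2 = l i - l j.
Proof.
move: j; apply: ord3P => H S.
- have -> : A 0 = - A 1 - A 2 by lra.
  rewrite !H //; clear; move: i; apply: ord3P; rewrite /= ?mulr1n ?mulr0n; ring.
- have -> : A 1 = - A 0 - A 2 by lra.
  rewrite !H //; clear; move: i; apply: ord3P; rewrite /= ?mulr1n ?mulr0n; ring.
- have -> : A 2 = - A 0 - A 1 by lra.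
  rewrite !H //; clear; move: i; apply: ord3P; rewrite /= ?mulr1n ?mulr0n; ring.
Qed.

Section triangle.
Variables (R : realType) (v : 'I_3 -> R * R).
Hypothesis v_indep : affinely_independent v.
Variable lam : 'I_3 -> R * R -> R.
Hypothesis lam_bary : barycentric_coords v lam.

Let sum_lam p : lam 0 p + lam 1 p + lam 2 p = 1.
Proof. by have [+ _] := lam_bary p; rewrite sum_ord3. Qed.

Let lam_fst p : p.1 = lam 0 p * (v 0).1 + lam 1 p * (v 1).1 + lam 2 p * (v 2).1.
Proof. by have [_ {1}->] := lam_bary p; rewrite sum_ord3. Qed.

Let lam_snd p : p.2 = lam 0 p * (v 0).2 + lam 1 p * (v 1).2 + lam 2 p * (v 2).2.
Proof. by have [_ {1}->] := lam_bary p; rewrite sum_ord3. Qed.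

Lemma lam_unique (c : 'I_3 -> R) p : \sum_i c i = 1 -> p = \sum_i c i *: v i ->
  forall i, c i = lam i p.
Proof.
move=> c1 pE i; have [l1 lE] := lam_bary p.
apply/eqP; rewrite -subr_eq0; apply/eqP.
apply: (v_indep (c := fun i => c i - lam i p)); first by rewrite sumrB c1 l1 subrr.
by under eq_bigr do rewrite scalerBl; rewrite sumrB -lE -pE subrr.
Qed.

Lemma hullE p : hull v p <-> forall i, 0 <= lam i p.
Proof.
split=> [[c [c0 c1 pE]] i|l0]; first by rewrite -(lam_unique c1 pE).
by exists (fun i => lam i p); have [] := lam_bary p.
Qed.

Lemma hull_vertex (w : 'I_3 -> R * R) m : hull w (w m).
Proof.
exists (fun i => (i == m)%:R); split=> [i||].
- exact: ler0n.
- by rewrite (bigD1 m) //= eqxx big1 ?addr0 // => i /negbTE ->.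
- by rewrite (bigD1 m) //= eqxx scale1r big1 ?addr0 // => i /negbTE ->; rewrite scale0r.
Qed.

(** Weights with respect to the vertices of the triangle of a point given by weights
[c] with respect to the vertices of a subtriangle: the weight of the barycenter
is shared equally. *)
Let flatten_weights (c : 'I_3 -> R) (j i : 'I_3) : R :=
  (if i == j then 0 else c i) + c j / 3.

Let sum_flatten_weights c j : \sum_i flatten_weights c j i = \sum_i c i.
Proof. by rewrite /flatten_weights !sum_ord3; move: j; apply: ord3P => /=; field. Qed.

Let flatten_weights_comb c j :
  \sum_i c i *: (if i == j then barycenter v else v i) =
  \sum_i flatten_weights c j i *: v i.
Proof.
rewrite /flatten_weights /barycenter !sum_ord3; apply: plane_eq; move: j; apply: ord3P.
all: by rewrite /= /GRing.scale /=; field.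
Qed.

Lemma subtriE j p : subtri v j p <-> 0 <= lam j p /\ forall i, lam j p <= lam i p.
Proof.
pose c' c := flatten_weights c j.
have sumE c : \sum_i c' c i = \sum_i c i by exact: sum_flatten_weights.
have combE c : \sum_i c i *: (if i == j then barycenter v else v i) =
  \sum_i c' c i *: v i by exact: flatten_weights_comb.
split=> [[c [c0 c1 pE]]|[l0 lj]].
  have lamE i : c' c i = lam i p.
    by apply: lam_unique; [rewrite sumE|rewrite pE combE].
  rewrite -lamE {1}/c' /flatten_weights eqxx add0r divr_ge0 //; split => // i.
  by rewrite -!lamE /c' /flatten_weights eqxx add0r lerDr; case: ifP.
pose c i := if i == j then 3 * lam j p else lam i p - lam j p.
have cE i : c' c i = lam i p.
  rewrite /c' /flatten_weights /c eqxx; case: eqVneq => [->|_]; by field.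
exists c; split=> [i| |].
- by rewrite /c; case: ifP => _; rewrite ?subr_ge0 // mulr_ge0.
- by rewrite -sumE; under eq_bigr do rewrite cE; have [] := lam_bary p.
- by rewrite combE; under eq_bigr do rewrite cE; have [] := lam_bary p.
Qed.

Section hats.
Variable lamR : 'I_3 -> R * R -> R.
Hypothesis lamR_hats : refined_hats v lamR.

(** Both sides are affine on the subtriangle and agree at its three vertices. *)
Lemma refined_hatE i j p : subtri v j p -> lamR i p = lam i p - lam j p.
Proof.
have [_ /(_ j)[a [b [c aff]]] lamRv lamRc] := lamR_hats i.
move=> Tp; rewrite aff //.
pose A q := a * q.1 + b * q.2 + c.
have Av m : m != j -> A (v m) = (m == i)%:R.
  move=> mj; rewrite -lamRv /A -aff //.
  have := hull_vertex (fun m => if m == j then barycenter v else v m) m.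
  by rewrite (negbTE mj).
have Ac : A (barycenter v) = 0.
  rewrite -lamRc /A -aff //.
  have := hull_vertex (fun m => if m == j then barycenter v else v m) j.
  by rewrite eqxx.
have Ac3 : A (v 0) + A (v 1) + A (v 2) = 0.
  have -> : A (v 0) + A (v 1) + A (v 2) = 3 * A (barycenter v).
    by rewrite /A /barycenter /= /GRing.scale /=; field.
  by rewrite Ac mulr0.
have -> : a * p.1 + b * p.2 + c =
    lam 0 p * A (v 0) + lam 1 p * A (v 1) + lam 2 p * A (v 2).
  rewrite (lam_fst p) (lam_snd p) /A.
  by rewrite -[X in _ + X = _]mulr1 -(sum_lam p); ring.
exact: (@hat_values R j i (lam ^~ p) (A \o v) Av Ac3).
Qed.
End hats.
End triangle.

Lemma indic1 (R : realType) (A : set (R * R)) p : A p -> \1_A p = 1 :> R.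
Proof. by move=> Ap; rewrite indicE mem_set. Qed.

Lemma indic0 (R : realType) (A : set (R * R)) p : ~ A p -> \1_A p = 0 :> R.
Proof. by move=> Ap; rewrite indicE memNset. Qed.

Definition tri_det (R : realType) (v : 'I_3 -> R * R) : R :=
  (v 1 - v 0).1 * (v 2 - v 0).2 - (v 1 - v 0).2 * (v 2 - v 0).1.

(** If the determinant vanishes, its cofactors are the coefficients of two linear
relations between the edges at v_0. *)
Lemma tri_det_neq0 (R : realType) (v : 'I_3 -> R * R) :
  affinely_independent v -> tri_det v != 0.
Proof.
move=> vI; apply/eqP => d0.
have zero (m n : R) : m *: (v 1 - v 0) + n *: (v 2 - v 0) = 0 -> m = 0 /\ n = 0.
  move=> mn.
  pose c (i : 'I_3) : R := if i == 0 then - m - n else if i == 1 then m else n.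
  have c0 : \sum_i c i = 0 by rewrite sum_ord3 /c /=; ring.
  have cv : \sum_i c i *: v i = 0.
    have := congr1 snd mn; have := congr1 fst mn.
    rewrite /= /GRing.scale /= => e1 e2.
    by apply: plane_eq; rewrite sum_ord3 /c /= /GRing.scale /=; lra.
  by have := vI c c0 cv; move=> H; split; [exact: (H 1)|exact: (H 2)].
have /zero[b2 a2] : (v 2 - v 0).2 *: (v 1 - v 0) + (- (v 1 - v 0).2) *: (v 2 - v 0) = 0.
  apply: plane_eq; move: d0; rewrite /tri_det /= /GRing.scale /= => d0; lra.
have /zero[b1 a1] : (v 2 - v 0).1 *: (v 1 - v 0) + (- (v 1 - v 0).1) *: (v 2 - v 0) = 0.
  apply: plane_eq; move: d0; rewrite /tri_det /= /GRing.scale /= => d0; lra.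
have v10 : v 1 - v 0 = 0 by apply: plane_eq; rewrite /=; move: a1 a2 => /= a1 a2; lra.
have [|/eqP] := zero 1 0; first by rewrite v10 scaler0 scale0r addr0.
by rewrite oner_eq0.
Qed.

Section triangle.
Variables (R : realType) (v : 'I_3 -> R * R).
Hypothesis v_indep : affinely_independent v.
Variables lam lamR : 'I_3 -> R * R -> R.
Hypothesis lam_bary : barycentric_coords v lam.
Hypothesis lamR_hats : refined_hats v lamR.

Local Notation d := (tri_det v).
Local Notation vc := (barycenter v).

(** lambda_0 - lambda_1 and lambda_0 - lambda_2 in Cartesian coordinates.  The first
vanishes at the barycenter and at v_2, so its gradient is orthogonal to t_{c,2};
the second likewise with v_1 and t_{c,1}. *)
Definition diff01_x := 3 * (vc.2 - (v 2).2) / d.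
Definition diff01_y := 3 * ((v 2).1 - vc.1) / d.
Definition diff01_c := - (diff01_x * vc.1 + diff01_y * vc.2).
Definition diff02_x := 3 * ((v 1).2 - vc.2) / d.
Definition diff02_y := 3 * (vc.1 - (v 1).1) / d.
Definition diff02_c := - (diff02_x * vc.1 + diff02_y * vc.2).
Definition diff01 (p : R * R) := diff01_x * p.1 + diff01_y * p.2 + diff01_c.
Definition diff02 (p : R * R) := diff02_x * p.1 + diff02_y * p.2 + diff02_c.

Lemma diff_det : diff01_x * diff02_y - diff01_y * diff02_x = 3 / d.
Proof.
have := tri_det_neq0 v_indep.
rewrite /diff01_x /diff01_y /diff02_x /diff02_y /barycenter /= /GRing.scale /=.
rewrite /tri_det /= => d0.
by field.
Qed.

Lemma lam01E p : lam 0 p - lam 1 p = diff01 p.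
Proof.
have [s pE] := lam_bary p; rewrite sum_ord3 in s; rewrite sum_ord3 in pE.
have p1 := congr1 fst pE; have p2 := congr1 snd pE.
have := tri_det_neq0 v_indep.
have l0 : lam 0 p = 1 - lam 1 p - lam 2 p by lra.
rewrite /diff01 /diff01_c /diff01_x /diff01_y p1 p2 l0 /barycenter /=.
rewrite /GRing.scale /= /tri_det /= => d0.
by field.
Qed.

Lemma lam02E p : lam 0 p - lam 2 p = diff02 p.
Proof.
have [s pE] := lam_bary p; rewrite sum_ord3 in s; rewrite sum_ord3 in pE.
have p1 := congr1 fst pE; have p2 := congr1 snd pE.
have := tri_det_neq0 v_indep.
have l0 : lam 0 p = 1 - lam 1 p - lam 2 p by lra.
rewrite /diff02 /diff02_c /diff02_x /diff02_y p1 p2 l0 /barycenter /=.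
rewrite /GRing.scale /= /tri_det /= => d0.
by field.
Qed.

Lemma lam_diffE p : [/\ lam 0 p = (1 + diff01 p + diff02 p) / 3,
  lam 1 p = (1 - 2 * diff01 p + diff02 p) / 3 &
  lam 2 p = (1 + diff01 p - 2 * diff02 p) / 3].
Proof.
have [s _] := lam_bary p; rewrite sum_ord3 in s.
rewrite -lam01E -lam02E; split; lra.
Qed.

Lemma hull_diffE p : hull v p <->
  [/\ 0 <= 1 + diff01 p + diff02 p, 0 <= 1 - 2 * diff01 p + diff02 p &
      0 <= 1 + diff01 p - 2 * diff02 p].
Proof.
have [l0 l1 l2] := lam_diffE p; split.
  move=> /(hullE v_indep lam_bary) h.
  by have := h 0; have := h 1; have := h 2; split; lra.
move=> [h0 h1 h2]; apply/(hullE v_indep lam_bary).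
by apply: ord3P; lra.
Qed.

Lemma subtri1_diffE p : subtri v 1 p <->
  [/\ 0 <= 1 - 2 * diff01 p + diff02 p, 0 <= diff01 p & diff02 p <= diff01 p].
Proof.
have [l0 l1 l2] := lam_diffE p; split.
  move=> /(subtriE v_indep lam_bary)[h /[dup] /(_ 0) h0 /(_ 2) h2].
  by split; lra.
move=> [h0 h1 h2]; apply/(subtriE v_indep lam_bary).
by split; [lra|apply: ord3P; lra].
Qed.

Lemma subtri2_diffE p : subtri v 2 p <->
  [/\ 0 <= 1 + diff01 p - 2 * diff02 p, 0 <= diff02 p & diff01 p <= diff02 p].
Proof.
have [l0 l1 l2] := lam_diffE p; split.
  move=> /(subtriE v_indep lam_bary)[h /[dup] /(_ 0) h0 /(_ 1) h2].
  by split; lra.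
move=> [h0 h1 h2]; apply/(subtriE v_indep lam_bary).
by split; [lra|apply: ord3P; lra].
Qed.

Lemma subtri0_diff p : hull v p -> diff01 p <= 0 -> diff02 p <= 0 -> subtri v 0 p.
Proof.
have [l0 l1 l2] := lam_diffE p.
move=> /(hullE v_indep lam_bary) /(_ 0) h X0 Y0; apply/(subtriE v_indep lam_bary).
by split => //; apply: ord3P; lra.
Qed.

Lemma hats_on_subtri1 p : subtri v 1 p ->
  lamR 0 p = diff01 p /\ lamR 2 p = diff01 p - diff02 p.
Proof.
move=> T; rewrite !(refined_hatE lam_bary lamR_hats _ T) -lam01E -lam02E.
by split => //; ring.
Qed.

Lemma hats_on_subtri2 p : subtri v 2 p ->
  lamR 0 p = diff02 p /\ lamR 1 p = diff02 p - diff01 p.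
Proof.
move=> T; rewrite !(refined_hatE lam_bary lamR_hats _ T) -lam01E -lam02E.
by split => //; ring.
Qed.

Lemma hat0_on_subtri0 p : subtri v 0 p -> lamR 0 p = 0.
Proof.
by move=> T; rewrite (refined_hatE lam_bary lamR_hats _ T) subrr.
Qed.

Lemma subtri_cases p : hull v p -> [\/ subtri v 1 p, subtri v 2 p |
  diff01 p < 0 /\ diff02 p < 0 ].
Proof.
move=> /hull_diffE[h0 h1 h2].
have [XY|XY] := lerP (diff02 p) (diff01 p).
- have [X0|X0] := lerP 0 (diff01 p).
    by constructor 1; apply/subtri1_diffE.
  by constructor 3; lra.
- have [Y0|Y0] := lerP 0 (diff02 p).
    by constructor 2; apply/subtri2_diffE; split => //; lra.
  by constructor 3; lra.
Qed.

(** The coordinates lambda_1 and lambda_2 map the triangle to the unit triangle,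
with determinant [1 / d]. *)
Lemma areaE : 4 * area (hull v) ^+ 2 = d ^+ 2.
Proof.
have d0 := tri_det_neq0 v_indep.
pose a1 := (diff02_x - 2 * diff01_x) / 3; pose b1 := (diff02_y - 2 * diff01_y) / 3.
pose a2 := (diff01_x - 2 * diff02_x) / 3; pose b2 := (diff01_y - 2 * diff02_y) / 3.
pose c1 := (1 - 2 * diff01_c + diff02_c) / 3.
pose c2 := (1 + diff01_c - 2 * diff02_c) / 3.
have D : a1 * b2 - a2 * b1 = d^-1.
  have -> : a1 * b2 - a2 * b1 = (diff01_x * diff02_y - diff01_y * diff02_x) / 3.
    by rewrite /a1 /b2 /a2 /b1; field.
  by rewrite diff_det; field.
have := @mu2_triangle R a1 b1 c1 a2 b2 c2.
rewrite D invr_eq0 => /(_ d0) A.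
rewrite /area (_ : hull v =
  [set p : R * R | unit_triangle (a1 * p.1 + b1 * p.2 + c1, a2 * p.1 + b2 * p.2 + c2)]).
  rewrite A /= invfM normfV invrK exprMn real_normK ?num_real //; by field.
apply/seteqP; split => p.
  move=> /hull_diffE; rewrite /diff01 /diff02 => -[h0 h1 h2].
  by rewrite /unit_triangle /a1 /a2 /b1 /b2 /c1 /c2; split => /=; lra.
rewrite /unit_triangle /a1 /a2 /b1 /b2 /c1 /c2 => -[/= h0 h1 h2].
by apply/hull_diffE; rewrite /diff01 /diff02; split; lra.
Qed.

Variable k : nat.
Hypothesis k_gt0 : (0 < k)%N.

Lemma lam21E p : lam 2 p - lam 1 p = diff01 p - diff02 p.
Proof. by rewrite -lam01E -lam02E; ring. Qed.

Lemma hat0_eq0 p : hull v p -> diff01 p < 0 -> diff02 p < 0 -> lamR 0 p = 0.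
Proof.
move=> hp X0 Y0; apply: hat0_on_subtri0.
by apply: subtri0_diff => //; exact: ltW.
Qed.

Lemma v0_piecewiseE p : hull v p ->
  v0_fun v k lam lamR p = v0_piecewise v k lamR p.
Proof.
move=> hp; rewrite /v0_fun /v0_piecewise lam21E.
have [T1|T2|[X0 Y0]] := subtri_cases hp; last first.
- by rewrite (hat0_eq0 hp X0 Y0) expr0n /= mulr0 !mul0r.
- have [_ ->] := hats_on_subtri2 T2; rewrite (indic1 T2) mulr1; congr (_ * _).
  have [T1|T1] := pselect (subtri v 1 p); last by rewrite (indic0 T1) mulr0; ring.
  have [_ ->] := hats_on_subtri1 T1; rewrite (indic1 T1).
  by move: T1 T2 => /subtri1_diffE[_ _ YX] /subtri2_diffE[_ _ XY]; lra.
- have [_ ->] := hats_on_subtri1 T1; rewrite (indic1 T1) mulr1; congr (_ * _).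
  have [T2|T2] := pselect (subtri v 2 p); last by rewrite (indic0 T2) mulr0; ring.
  have [_ ->] := hats_on_subtri2 T2; rewrite (indic1 T2).
  by move: T1 T2 => /subtri1_diffE[_ _ YX] /subtri2_diffE[_ _ XY]; lra.
Qed.

Definition v0_coef : R := d ^+ 2 / (9 * k.+1%:R).

Lemma v0_funE p : hull v p ->
  v0_fun v k lam lamR p = v0_coef *
    potential diff01_x diff01_y diff01_c diff02_x diff02_y diff02_c k p.
Proof.
move=> hp; rewrite /v0_fun areaE -/v0_coef -mulrA lam21E.
rewrite /potential -/(diff01 p) -/(diff02 p).
congr (_ * (_ * _)).
have [T1|T2|[X0 Y0]] := subtri_cases hp.
- have [-> _] := hats_on_subtri1 T1; move/subtri1_diffE: T1 => [_ X0 YX].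
  rewrite max_l // /ramp; case: ltP => // X0'.
  have -> : diff01 p = 0 by lra.
  by rewrite expr0n.
- have [-> _] := hats_on_subtri2 T2; move/subtri2_diffE: T2 => [_ Y0 XY].
  rewrite max_r // /ramp; case: ltP => // Y0'.
  have -> : diff02 p = 0 by lra.
  by rewrite expr0n.
- rewrite (hat0_eq0 hp X0 Y0) expr0n /= /ramp ifF //.
  by apply: negbTE; rewrite -leNgt ge_max !ltW.
Qed.

(** The components of t_{c,i}. *)
Definition spoke (i : 'I_3) (r : 'I_2) : R := edge vc (v i) r 0.

(** The value of a refined hat function is known on each subtriangle, and the
indicator functions cancel all other values: the formula holds at every point,
which makes the measurability of the entries evident. *)
Lemma psi0_entry p r s : psi0 v k lamR p r s =
  \1_(subtri v 2) p * (diff02 p ^+ k * (spoke 0 r * spoke 1 s + spoke 0 s * spoke 1 r)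
     - k%:R * diff02 p ^+ k.-1 * (diff02 p - diff01 p) * (spoke 1 r * spoke 1 s)) +
  \1_(subtri v 1) p *
    (k%:R * diff01 p ^+ k.-1 * (diff01 p - diff02 p) * (spoke 2 r * spoke 2 s)
     - diff01 p ^+ k * (spoke 0 r * spoke 2 s + spoke 0 s * spoke 2 r)).
Proof.
rewrite /psi0 /symp /outer /spoke !mxE !big_ord1 !mxE.
congr (_ + _).
- have [T2|T2] := pselect (subtri v 2 p); last by rewrite (indic0 T2) !mul0r.
  have [-> ->] := hats_on_subtri2 T2; rewrite (indic1 T2); by field.
- have [T1|T1] := pselect (subtri v 1 p); last by rewrite (indic0 T1) !mul0r.
  have [-> ->] := hats_on_subtri1 T1; rewrite (indic1 T1); by field.
Qed.

Lemma psi0_sym p r s : psi0 v k lamR p r s = psi0 v k lamR p s r.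
Proof. rewrite !psi0_entry; congr (_ * _ + _ * _); ring. Qed.

(** The Airy matrix is the Hessian taken along these two directions. *)
Definition turned_axis (r : 'I_2) : R * R :=
  if r == 0 then axis R 1 else - axis R 0.

Lemma diff01_turned r :
  diff01_x * (turned_axis r).1 + diff01_y * (turned_axis r).2 = 3 / d * spoke 2 r.
Proof.
rewrite /turned_axis /spoke /edge mxE /diff01_x /diff01_y; case: ifP => _;
  rewrite /axis /= /GRing.scale /=; ring.
Qed.

Lemma diff02_turned r :
  diff02_x * (turned_axis r).1 + diff02_y * (turned_axis r).2 = - (3 / d * spoke 1 r).
Proof.
rewrite /turned_axis /spoke /edge mxE /diff02_x /diff02_y; case: ifP => _;
  rewrite /axis /= /GRing.scale /=; ring.
Qed.

Lemma spoke_sum r : spoke 0 r = - spoke 1 r - spoke 2 r.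
Proof.
rewrite /spoke /edge !mxE.
by case: ifP => _; rewrite /barycenter /= /GRing.scale /=; field.
Qed.

(** Off the three lines exactly one formula for the second derivatives applies, and
it is an identity between polynomials in the components of t_{c,1}, t_{c,2}. *)
Lemma psi0_potential p r s : hull v p ->
  diff01 p != 0 -> diff02 p != 0 -> diff01 p != diff02 p ->
  psi0 v k lamR p r s = v0_coef *
    potential_deriv2 diff01_x diff01_y diff01_c diff02_x diff02_y diff02_c k
      (turned_axis r) (turned_axis s) p.
Proof.
move=> hp X0 Y0 XY0; rewrite psi0_entry /potential_deriv2 -/(diff01 p) -/(diff02 p).
rewrite !diff01_turned !diff02_turned !spoke_sum /v0_coef.
have d0 := tri_det_neq0 v_indep.
have k10 : k.+1%:R != 0 :> R by rewrite pnatr_eq0.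
have [XY|YX|XY] := ltgtP (diff01 p) (diff02 p); last by rewrite XY eqxx in XY0.
- rewrite (indic0 (A := subtri v 1)) ?mul0r ?addr0; last first.
    by move=> /subtri1_diffE[_ _]; rewrite leNgt XY.
  have [Yn|Yp|Y0'] := ltgtP (diff02 p) 0; last by rewrite Y0' eqxx in Y0.
    rewrite (indic0 (A := subtri v 2)) ?mul0r; last first.
      by move=> /subtri2_diffE[_ + _]; rewrite leNgt Yn.
    by rewrite /ramp ltNge (ltW Yn) /= !(mulr0, mul0r, addr0).
  rewrite (indic1 (A := subtri v 2)); last first.
    by apply/subtri2_diffE; move/hull_diffE: hp => [? ? ?]; split => //; exact: ltW.
  rewrite /ramp Yp; move: (k.+1%:R : R) k10 => K K0.
  by field; rewrite d0 K0.
- rewrite (indic0 (A := subtri v 2)) ?mul0r ?add0r; last first.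
    by move=> /subtri2_diffE[_ _]; rewrite leNgt YX.
  have [Xn|Xp|X0'] := ltgtP (diff01 p) 0; last by rewrite X0' eqxx in X0.
    rewrite (indic0 (A := subtri v 1)) ?mul0r; last first.
      by move=> /subtri1_diffE[_ + _]; rewrite leNgt Xn.
    by rewrite /ramp ltNge (ltW Xn) /= !(mulr0, mul0r, addr0).
  rewrite (indic1 (A := subtri v 1)); last first.
    by apply/subtri1_diffE; move/hull_diffE: hp => [? ? ?]; split => //; exact: ltW.
  rewrite /ramp Xp; move: (k.+1%:R : R) k10 => K K0.
  by field; rewrite d0 K0.
Qed.

Lemma ae_off_lines :
  {ae mu2 R, forall p : plane R,
    [/\ diff01 p != 0, diff02 p != 0 & diff01 p != diff02 p]}.
Proof.
have D : diff01_x * diff02_y - diff01_y * diff02_x != 0.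
  by rewrite diff_det mulf_neq0 ?invr_eq0 ?tri_det_neq0.
have mline (a b c : R) : (a != 0) || (b != 0) ->
    {ae mu2 R, forall p : plane R, a * p.1 + b * p.2 + c != 0}.
  move=> ab; exists [set p : plane R | a * p.1 + b * p.2 + c = 0]; split.
  - exact: measurable_line.
  - exact: mu2_line.
  - by move=> p /= /negP; rewrite negbK => /eqP.
have aX : {ae mu2 R, forall p : plane R, diff01 p != 0}.
  by apply: mline; apply: contraNT D; rewrite negb_or !negbK => /andP[/eqP-> /eqP->];
    rewrite !mul0r subrr.
have aY : {ae mu2 R, forall p : plane R, diff02 p != 0}.
  by apply: mline; apply: contraNT D; rewrite negb_or !negbK => /andP[/eqP-> /eqP->];
    rewrite !mulr0 subrr.
have aXY : {ae mu2 R, forall p : plane R, (diff01_x - diff02_x) * p.1 +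
    (diff01_y - diff02_y) * p.2 + (diff01_c - diff02_c) != 0}.
  apply: mline; apply: contraNT D; rewrite negb_or !negbK !subr_eq0 => /andP[/eqP-> /eqP->].
  by apply/eqP; ring.
apply: filterS3 aX aY aXY => p pX pY pXY; split => //.
rewrite -subr_eq0; apply: contraNneq pXY => pE; apply/eqP.
by rewrite -[RHS]pE /diff01 /diff02; ring.
Qed.

End triangle.

(** * The Airy operator and the divergence on the triangle *)

Lemma Rintegral_test (R : realType) (A : set (R * R)) (f g phi : R * R -> R) :
  test_function A° phi -> (forall p, A p -> f p = g p) ->
  \int[mu2 R]_(p in A) (f p * phi p) = \int[mu2 R]_p (g p * phi p).
Proof.
move=> tphi fg; rewrite Rintegral_mkcond; apply: eq_Rintegral => p _.
rewrite /patch; case: ifPn => [|]; first by rewrite inE => /fg ->.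
rewrite notin_setE => nA; rewrite (test_function_eq0 tphi) ?mulr0 //.
by move=> /interior_subset.
Qed.

Lemma L1locN (R : realType) (U : set (R * R)) (g : R * R -> R) :
  L1loc U g -> L1loc U (fun p => - g p).
Proof.
by move=> Lg K cK KU; have := integrableN (Lg K cK KU).
Qed.

Lemma ae_eq_Rintegral (R : realType) (A : set (plane R)) (f g : plane R -> R) :
  measurable A -> measurable_fun A f -> measurable_fun A g ->
  {ae mu2 R, forall p, A p -> f p = g p} ->
  \int[mu2 R]_(p in A) f p = \int[mu2 R]_(p in A) g p.
Proof.
move=> mA mf mg fg; rewrite /Rintegral; congr fine; apply: ae_eq_integral => //.
- exact/measurable_EFinP.
- exact/measurable_EFinP.
- by apply: filterS fg => p h Ap; rewrite h.
Qed.

Section triangle.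
Variables (R : realType) (v : 'I_3 -> R * R).
Hypothesis v_indep : affinely_independent v.
Variables lam lamR : 'I_3 -> R * R -> R.
Hypothesis lam_bary : barycentric_coords v lam.
Hypothesis lamR_hats : refined_hats v lamR.
Variable k : nat.
Hypothesis k_gt0 : (0 < k)%N.

Local Notation A := (hull v).
Local Notation d01 := (diff01 v).
Local Notation d02 := (diff02 v).
Local Notation f := (v0_fun v k lam lamR).
Local Notation psi := (psi0 v k lamR).
Let pot : R * R -> R := fun p =>
  v0_coef v k * potential (diff01_x v) (diff01_y v) (diff01_c v)
    (diff02_x v) (diff02_y v) (diff02_c v) k p.
Let dpot (w p : R * R) : R :=
  v0_coef v k * potential_deriv (diff01_x v) (diff01_y v) (diff01_c v)
    (diff02_x v) (diff02_y v) (diff02_c v) k w p.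
Let ddpot (w u p : R * R) : R :=
  v0_coef v k * potential_deriv2 (diff01_x v) (diff01_y v) (diff01_c v)
    (diff02_x v) (diff02_y v) (diff02_c v) k w u p.

Let hullP p := hull_diffE v_indep lam_bary p.

Let measurable_diff (a b c : R) :
  measurable [set p : plane R | 0 <= a + b * d01 p + c * d02 p].
Proof.
rewrite (_ : [set _ | _] = [set p : plane R |
  0 <= (b * diff01_x v + c * diff02_x v) * p.1
     + (b * diff01_y v + c * diff02_y v) * p.2
     + (a + b * diff01_c v + c * diff02_c v)]).
  exact: measurable_half_plane.
by apply/seteqP; split => p; rewrite /diff01 /diff02 /=; lra.
Qed.

Lemma measurable_hull : measurable (A : set (plane R)).
Proof.
rewrite (_ : A = [set p : plane R | 0 <= 1 + 1 * d01 p + 1 * d02 p] `&`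
  [set p : plane R | 0 <= 1 + (-2) * d01 p + 1 * d02 p] `&`
  [set p : plane R | 0 <= 1 + 1 * d01 p + (-2) * d02 p]).
  by apply: measurableI; [apply: measurableI|]; exact: measurable_diff.
apply/seteqP; split => p.
  by move=> /hullP[h0 h1 h2]; split; [split|]; rewrite /=; lra.
by move=> [[/= h0 h1] h2]; apply/hullP; split; lra.
Qed.

Lemma measurable_subtri1 : measurable (subtri v 1 : set (plane R)).
Proof.
rewrite (_ : subtri v 1 = [set p : plane R | 0 <= 1 + (-2) * d01 p + 1 * d02 p] `&`
  [set p : plane R | 0 <= 0 + 1 * d01 p + 0 * d02 p] `&`
  [set p : plane R | 0 <= 0 + 1 * d01 p + (-1) * d02 p]).
  by apply: measurableI; [apply: measurableI|]; exact: measurable_diff.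
apply/seteqP; split => p.
  move=> /(subtri1_diffE v_indep lam_bary)[h0 h1 h2].
  by split; [split|]; rewrite /=; lra.
by move=> [[/= h0 h1] h2]; apply/(subtri1_diffE v_indep lam_bary); split; lra.
Qed.

Lemma measurable_subtri2 : measurable (subtri v 2 : set (plane R)).
Proof.
rewrite (_ : subtri v 2 = [set p : plane R | 0 <= 1 + 1 * d01 p + (-2) * d02 p] `&`
  [set p : plane R | 0 <= 0 + 0 * d01 p + 1 * d02 p] `&`
  [set p : plane R | 0 <= 0 + (-1) * d01 p + 1 * d02 p]).
  by apply: measurableI; [apply: measurableI|]; exact: measurable_diff.
apply/seteqP; split => p.
  move=> /(subtri2_diffE v_indep lam_bary)[h0 h1 h2].
  by split; [split|]; rewrite /=; lra.
by move=> [[/= h0 h1] h2]; apply/(subtri2_diffE v_indep lam_bary); split; lra.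
Qed.

Lemma hull_bounded : exists r, forall p, A p -> `|p| <= r.
Proof.
exists (`|v 0| + `|v 1| + `|v 2|) => p [c [c0 c1 ->]].
rewrite !sum_ord3 in c1 *.
have cv i : `|c i *: v i| <= `|v i|.
  rewrite normrZ ger0_norm // ler_piMl //.
  have := c0 0; have := c0 1; have := c0 2; move: i; apply: ord3P; lra.
do 2 (apply: le_trans (ler_normD _ _) _; apply: lerD; last exact: cv).
exact: cv.
Qed.

Let lX w : lipschitz_along w d01. Proof. exact: lipschitz_along_affine. Qed.
Let lY w : lipschitz_along w d02. Proof. exact: lipschitz_along_affine. Qed.

Lemma psi0_measurable r s : measurable_fun setT (fun p : plane R => psi p r s).
Proof.
have mX : measurable_fun setT (d01 : plane R -> measurableTypeR R).
  exact: measurable_affine.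
have mY : measurable_fun setT (d02 : plane R -> measurableTypeR R).
  exact: measurable_affine.
under eq_fun do rewrite (psi0_entry v_indep lam_bary lamR_hats).
apply: measurable_funD.
- apply: measurable_funM; first exact: measurable_indic measurable_subtri2.
  apply: measurable_funB; apply: measurable_funM => //; try exact: measurable_funX.
  apply: measurable_funM; last exact: measurable_funB.
  by apply: measurable_funM => //; exact: measurable_funX.
- apply: measurable_funM; first exact: measurable_indic measurable_subtri1.
  apply: measurable_funB; apply: measurable_funM => //; try exact: measurable_funX.
  apply: measurable_funM; last exact: measurable_funB.
  by apply: measurable_funM => //; exact: measurable_funX.
Qed.

Lemma psi0_bounded r s : exists M, forall p, A p -> `|psi p r s| <= M.
Proof.
have [rho hr] := hull_bounded.
have piece (Z W : R * R -> R) (a b : R) : lipschitz_along 0 Z -> lipschitz_along 0 W ->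
  exists M, forall p, `|p| <= rho -> 
   `|k%:R * Z p ^+ k.-1 * (Z p - W p) * a - Z p ^+ k * b| <= M.
  move=> lZ lW; apply: (@lipschitz_along_bounded R 0).
  apply: lipschitz_alongB; last first.
    by apply: lipschitz_alongM; [exact: lipschitz_alongX|exact: lipschitz_along_cst].
  apply: lipschitz_alongM; last exact: lipschitz_along_cst.
  apply: lipschitz_alongM; last exact: lipschitz_alongB.
  by apply: lipschitz_alongZ; exact: lipschitz_alongX.
have [M1 M1P] := piece _ _ (spoke v 2 r * spoke v 2 s)
   (spoke v 0 r * spoke v 2 s + spoke v 0 s * spoke v 2 r) (lX 0) (lY 0).
have [M2 M2P] := piece _ _ (spoke v 1 r * spoke v 1 s)
   (spoke v 0 r * spoke v 1 s + spoke v 0 s * spoke v 1 r) (lY 0) (lX 0).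
exists (M2 + M1) => p Ap; rewrite (psi0_entry v_indep lam_bary lamR_hats).
have ind (B : set (R * R)) (z M : R) : `|z| <= M -> `|\1_B p * z| <= M.
  move=> zM; rewrite indicE; case: (p \in B); rewrite ?mul1r // mul0r normr0.
  exact: le_trans zM.
apply: le_trans (ler_normD _ _) _; apply: lerD; apply: ind; last exact: M1P (hr _ Ap).
by rewrite distrC; exact: M2P (hr _ Ap).
Qed.

Lemma pot_measurable : measurable_fun setT (pot : plane R -> measurableTypeR R).
Proof.
apply: measurable_funM => //; apply: continuous_measurable_plane.
exact: potential_continuous.
Qed.

Lemma pot_bounded : exists M, forall p, A p -> `|pot p| <= M.
Proof.
have [rho hr] := hull_bounded.
have [|M MP] := @lipschitz_along_bounded R 0 pot rho.
  by apply: lipschitz_alongZ; exact: potential_lipschitz.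
by exists M => p /hr /MP.
Qed.

Lemma hull_L1loc (g h : R * R -> R) :
  (forall p, A p -> g p = h p) ->
  measurable_fun setT (h : plane R -> measurableTypeR R) ->
  (exists M, forall p, A p -> `|h p| <= M) -> L1loc A° g.
Proof.
move=> gh mh [M hM] K cK KA.
have KA' p : K p -> A p by move=> /KA /interior_subset.
have mK := compact_measurable_plane cK.
have [rho hr] := hull_bounded.
have := @bounded_integrable_plane R K h M rho mK
  (measurable_funS measurableT (@subsetT _ _) mh).
move=> /(_ (fun p Kp => conj (hM p (KA' p Kp)) (hr p (KA' p Kp)))).
by apply: eq_integrable => // p; rewrite inE => Kp; rewrite /= gh //; exact: KA'.
Qed.

Lemma hull_L2 (h : R * R -> R) :
  measurable_fun setT (h : plane R -> measurableTypeR R) ->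
  (exists M, forall p, A p -> `|h p| <= M) -> L2 A h.
Proof.
move=> mh [M hM]; have [rho hr] := hull_bounded; split.
  exact: measurable_funS mh.
apply: (@bounded_integrable_plane R A _ (M ^+ 2) rho measurable_hull).
  by apply: measurable_funX; exact: measurable_funS mh.
move=> p Ap; split; last exact: hr.
have M0 : 0 <= M by apply: le_trans (hM p Ap).
by rewrite normrX lerXn2r ?nnegrE // hM.
Qed.

Lemma C1_on_v0 : C1_on A f.
Proof.
have fE p : A p -> pot p = f p.
  by move=> Ap; rewrite (v0_funE v_indep lam_bary lamR_hats).
split.
  have cpot : {within A, continuous pot}.
    apply: continuous_subspaceT => p; apply: cvgM; first exact: cvg_cst.
    exact: potential_continuous.
  have fE' : {in A, (pot : subspace A -> R) =1 f} by move=> p; rewrite inE; exact: fE.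
  exact: subspace_eq_continuous fE' cpot.
move=> i; exists (dpot (axis R i)).
  apply: continuous_subspaceT => p; apply: cvgM; first exact: cvg_cst.
  exact: potential_deriv_continuous.
move=> p Ap.
have : is_derive p (axis R i) pot (dpot (axis R i) p).
  by apply: is_derive_scale; exact: potential_is_derive.
by apply: near_eq_is_derive; apply: filterS Ap => q; exact: fE.
Qed.

Let ddpot_measurable w u :
  measurable_fun setT (ddpot w u : plane R -> measurableTypeR R).
Proof. by apply: measurable_funM => //; exact: potential_deriv2_measurable. Qed.

Lemma ddpot_weak i j phi : test_function A° phi ->
  (mu2 R).-integrable setT (EFin \o (fun p => ddpot (axis R i) (axis R j) p * phi p)) /\
  \int[mu2 R]_p (dpot (axis R i) p * partial j phi p) =
  - \int[mu2 R]_p (ddpot (axis R i) (axis R j) p * phi p).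
Proof.
move=> tphi; apply: (@weak_derivative_plane R A° (dpot (axis R i))
  (ddpot (axis R i) (axis R j)) j phi tphi) => //.
- by apply: lipschitz_alongZ; exact: potential_deriv_lipschitz.
- move=> p; apply: cvgM; first exact: cvg_cst.
  exact: potential_deriv_continuous.
- apply: filterS (ae_off_lines v_indep) => p [X0 Y0 XY0].
  by apply: is_derive_scale; exact: potential_deriv_is_derive.
Qed.

Lemma pot_weak i phi : test_function A° phi ->
  \int[mu2 R]_p (pot p * partial i phi p) =
  - \int[mu2 R]_p (dpot (axis R i) p * phi p).
Proof.
move=> tphi; have [||||] := @weak_derivative_plane R A° pot (dpot (axis R i)) i phi tphi.
- by apply: lipschitz_alongZ; exact: potential_lipschitz.
- move=> p; apply: cvgM; first exact: cvg_cst.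
  exact: potential_continuous.
- apply: continuous_measurable_plane => p; apply: cvgM; first exact: cvg_cst.
  exact: potential_deriv_continuous.
- by apply: aeW => p; apply: is_derive_scale; exact: potential_is_derive.
- by [].
Qed.

Lemma v0_weak i j phi : test_function A° phi ->
  \int[mu2 R]_(p in A) (f p * partial j (partial i phi) p) =
  \int[mu2 R]_p (ddpot (axis R j) (axis R i) p * phi p).
Proof.
move=> tphi.
have ti := test_function_partial i tphi; have tji := test_function_partial j ti.
rewrite (Rintegral_test tji (v0_funE v_indep lam_bary lamR_hats k)).
by rewrite pot_weak // (ddpot_weak _ _ tphi).2 opprK.
Qed.

(** The entries are the second derivatives off three lines, which are null sets. *)
Lemma psi0_weak r s phi : test_function A° phi ->
  \int[mu2 R]_(p in A) (psi p r s * phi p) =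
  \int[mu2 R]_p (ddpot (turned_axis R r) (turned_axis R s) p * phi p).
Proof.
move=> tphi.
have mphi := continuous_measurable_plane (test_function_continuous tphi).
rewrite (@ae_eq_Rintegral R A _
  (fun p => ddpot (turned_axis R r) (turned_axis R s) p * phi p)).
- exact: Rintegral_test.
- exact: measurable_hull.
- by apply: measurable_funM; apply: measurable_funTS => //; exact: psi0_measurable.
- by apply: measurable_funM; apply: measurable_funTS; [exact: ddpot_measurable|].
- apply: filterS (ae_off_lines v_indep) => p [X0 Y0 XY0] Ap.
  by rewrite (psi0_potential v_indep lam_bary lamR_hats).
Qed.

Let ddpotNl w u p : ddpot (- w) u p = - ddpot w u p.
Proof. by rewrite /ddpot /potential_deriv2 /=; case: ifP => _; ring. Qed.

Let ddpotNr w u p : ddpot w (- u) p = - ddpot w u p.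
Proof. by rewrite /ddpot /potential_deriv2 /=; case: ifP => _; ring. Qed.


Lemma psi0_L1loc r s : L1loc A° (fun p => psi p r s).
Proof. exact: hull_L1loc (psi0_measurable r s) (psi0_bounded r s). Qed.

Lemma v0_L1loc : L1loc A° f.
Proof.
apply: hull_L1loc pot_measurable pot_bounded.
exact: v0_funE.
Qed.

Lemma psi0_test_integrable r s phi : test_function A° phi ->
  (mu2 R).-integrable A (EFin \o (fun p => psi p r s * phi p)).
Proof.
move=> tphi; have [rho hr] := hull_bounded.
have [M hM] := psi0_bounded r s; have [N hN] := test_function_bounded tphi.
have mphi := continuous_measurable_plane (test_function_continuous tphi).
apply: (@bounded_integrable_plane R A _ (M * N) rho measurable_hull).
  by apply: measurable_funM; apply: measurable_funTS => //; exact: psi0_measurable.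
move=> p Ap; split; last exact: hr.
by rewrite normrM ler_pM // hM.
Qed.

Let RintegralN (D : set (plane R)) (g : plane R -> R) : measurable D ->
  (mu2 R).-integrable D (EFin \o g) ->
  \int[mu2 R]_(p in D) (- g p) = - \int[mu2 R]_(p in D) g p.
Proof.
move=> mD ig; rewrite -[RHS]mulN1r -RintegralZl //.
by apply: eq_Rintegral => p _; rewrite mulN1r.
Qed.

Lemma psi0_weakN r s phi : test_function A° phi ->
  \int[mu2 R]_(p in A) (- psi p r s * phi p) =
  - \int[mu2 R]_p (ddpot (turned_axis R r) (turned_axis R s) p * phi p).
Proof.
move=> tphi; rewrite -psi0_weak // -RintegralN.
- by apply: eq_Rintegral => p _; rewrite mulNr.
- exact: measurable_hull.
- exact: psi0_test_integrable.
Qed.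

Let ddpot_oppr_weak i j phi : test_function A° phi ->
  \int[mu2 R]_p (ddpot (axis R i) (- axis R j) p * phi p) =
  - \int[mu2 R]_p (ddpot (axis R i) (axis R j) p * phi p).
Proof.
move=> tphi; rewrite -RintegralN //; last exact: (ddpot_weak i j tphi).1.
by apply: eq_Rintegral => p _; rewrite ddpotNr mulNr.
Qed.

Let ddpot_oppl_weak i j phi : test_function A° phi ->
  \int[mu2 R]_p (ddpot (- axis R i) (axis R j) p * phi p) =
  - \int[mu2 R]_p (ddpot (axis R i) (axis R j) p * phi p).
Proof.
move=> tphi; rewrite -RintegralN //; last exact: (ddpot_weak i j tphi).1.
by apply: eq_Rintegral => p _; rewrite ddpotNl mulNr.
Qed.

Let ddpotC w u p : ddpot w u p = ddpot u w p.
Proof. by rewrite /ddpot /potential_deriv2; case: ifP => _; ring. Qed.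

Let rot0 : turned_axis R 0 = axis R 1. Proof. by []. Qed.
Let rot1 : turned_axis R 1 = - axis R 0. Proof. by []. Qed.

Lemma v0_weak_Airy : weak_Airy A f psi.
Proof.
split; split; try exact: v0_L1loc; try exact: psi0_L1loc;
  try (by apply: L1locN; exact: psi0_L1loc); move=> phi tphi; rewrite v0_weak //.
- by rewrite psi0_weak.
- rewrite psi0_weakN // rot0 rot1 ddpot_oppr_weak // opprK.
  by apply: eq_Rintegral => p _; rewrite ddpotC.
- rewrite psi0_weakN // rot0 rot1 ddpot_oppl_weak // opprK.
  by apply: eq_Rintegral => p _; rewrite ddpotC.
- rewrite psi0_weak // rot1.
  by apply: eq_Rintegral => p _; rewrite ddpotNl ddpotNr opprK.
Qed.

(** Up to sign, row [i] consists of the derivatives of one first derivative of v_0,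
so moving them to [phi] leaves the difference of the two mixed derivatives of
[phi]. *)
Lemma psi0_weak_div : weak_div A psi (fun=> 0).
Proof.
move=> i phi tphi.
have t0 := test_function_partial 0 tphi; have t1 := test_function_partial 1 tphi.
have -> : \int[mu2 R]_(p in A) ((0 : 'cV[R]_2) i 0 * phi p) = 0.
  transitivity (\int[mu2 R]_(p in A) (0 : R)).
    by apply: eq_Rintegral => p _; rewrite mxE mul0r.
  by rewrite /Rintegral integral0.
have -> : \int[mu2 R]_(p in A) (\sum_j psi p i j * partial j phi p) =
    \int[mu2 R]_(p in A) (psi p i 0 * partial 0 phi p + psi p i 1 * partial 1 phi p).
  apply: eq_Rintegral => p _; rewrite !big_ord_recl big_ord0 addr0.
  by congr (_ * _ + psi p i _ * partial _ phi p); exact: val_inj.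
rewrite RintegralD //; [|exact: measurable_hull|exact: psi0_test_integrable
  |exact: psi0_test_integrable].
rewrite !psi0_weak // rot0 rot1.
have E j : \int[mu2 R]_p (dpot (axis R j) p * partial 1 (partial 0 phi) p) =
    \int[mu2 R]_p (dpot (axis R j) p * partial 0 (partial 1 phi) p).
  by rewrite (test_function_partialC 1 0 tphi).
move: i; apply: ord2P.
- rewrite rot0 ddpot_oppr_weak //.
  have /oppr_inj e := etrans (esym (ddpot_weak 1 1 t0).2)
    (etrans (E 1) (ddpot_weak 1 0 t1).2).
  by rewrite e subrr oppr0.
- rewrite rot1 ddpot_oppl_weak //.
  have -> : \int[mu2 R]_p (ddpot (- axis R 0) (- axis R 0) p * partial 1 phi p) =
      \int[mu2 R]_p (ddpot (axis R 0) (axis R 0) p * partial 1 phi p).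
    by apply: eq_Rintegral => p _; rewrite ddpotNl ddpotNr opprK.
  have /oppr_inj e := etrans (esym (ddpot_weak 0 1 t0).2)
    (etrans (E 0) (ddpot_weak 0 0 t1).2).
  by rewrite e addNr oppr0.
Qed.

Lemma psi0_HdivS : HdivS A psi.
Proof.
split.
- move=> p _; apply/matrixP => r s; rewrite mxE.
  exact: (psi0_sym v_indep lam_bary lamR_hats).
- move=> r s; exact: hull_L2 (psi0_measurable r s) (psi0_bounded r s).
- exists (fun=> 0); last exact: psi0_weak_div.
  move=> i; apply: hull_L2.
    by under eq_fun do rewrite mxE; exact: measurable_cst.
  by exists 0 => p _; rewrite mxE normr0.
Qed.

End triangle.

Theorem lemma3p1 (R : realType) (v : 'I_3 -> R * R)
    (v_nondegenerate : affinely_independent v)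
    (lam lamR : 'I_3 -> R * R -> R)
    (lam_bary : barycentric_coords v lam)
    (lamR_hats : refined_hats v lamR)
    (k : nat) (k_ge1 : (1 <= k)%N) :
  [/\ forall p, hull v p -> v0_fun v k lam lamR p = v0_piecewise v k lamR p,
      C1_on (hull v) (v0_fun v k lam lamR),
      weak_Airy (hull v) (v0_fun v k lam lamR) (psi0 v k lamR),
      HdivS (hull v) (psi0 v k lamR) &
      weak_div (hull v) (psi0 v k lamR) (fun=> 0)].
Proof.
split.
- by move=> p; exact: v0_piecewiseE.
- exact: C1_on_v0.
- exact: v0_weak_Airy.
- exact: (psi0_HdivS v_nondegenerate lam_bary lamR_hats k_ge1).
- exact: (psi0_weak_div v_nondegenerate lam_bary lamR_hats k_ge1).
Qed.
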